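(* Let $X$ be a (non-commutative) space, and let $i:Y\to X$ and $\alpha:W\to X$ be the inclusions of an effective divisor and a weakly closed subspace respectively. Suppose that $M(Y)$ and $M(-Y)$ belong to $\mathrm{Mod}\,W$ whenever $M$ does. Then $W\cap Y$ is an effective divisor on $W$ if and only if $W\cap Y\neq\phi$ and $\mathcal{T}\!or^X_1(o_Y,o_W)=0$. The last condition ($\mathcal{T}\!or^X_1(o_Y,o_W)=0$) is equivalent to $i^*\alpha_*\alpha^!$ vanishing on all injective $X$-modules.
   Context: A (non-commutative) space $X$ is a Grothendieck category $\mathrm{Mod}\,X$; the empty space $\phi$ has $\mathrm{Mod}\,\phi=0$. A weakly closed subspace $W$ of $X$ is a full subcategory $\mathrm{Mod}\,W$ of $\mathrm{Mod}\,X$ closed under subquotients and whose inclusion functor $\alpha_*$ has a right adjoint $\alpha^!$; it is closed if $\alpha_*$ also has a left adjoint $\alpha^*$. $W\cap Y$ is given by $\mathrm{Mod}\,W\cap Y=\mathrm{Mod}\,W\cap\mathrm{Mod}\,Y$ (when $Y$ is closed in $X$ it is a closed subspace of $W$). Bimodules (Van den Bergh): the category of weak $X$-$X$-bimodules is the opposite of the category of left exact functors $\mathrm{Mod}\,X\to\mathrm{Mod}\,X$; the functor corresponding to $B$ is written $\mathcal{H}om_X(B,-)$, and its right derived functors are $\mathcal{E}xt^n_X(B,-)$. $B$ is an $X$-$X$-bimodule if $\mathcal{H}om_X(B,-)$ has a left adjoint, written $-\otimes_X B$. A sequence of weak bimodules $0\to B'\to B\to B''\to0$ is exact iff $0\to\mathcal{H}om_X(B'',E)\to\mathcal{H}om_X(B,E)\to\mathcal{H}om_X(B',E)\to0$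 is exact for every injective $E$; a weak bimodule is determined by the restriction of its functor to injectives. $o_X$ is the bimodule of the identity functor. A bimodule is invertible if its functor is an auto-equivalence. An effective divisor $Y$ on $X$ is an invertible proper subobject $o_X(-Y)$ of $o_X$; i.e. an invertible bimodule with a monomorphism $o_X(-Y)\to o_X$ that is not an isomorphism (monomorphism: $E\to\mathcal{H}om_X(o_X(-Y),E)$ is epic for all injective $E$). Write $M(-Y)=M\otimes_X o_X(-Y)$ and $M(Y)=\mathcal{H}om_X(o_X(-Y),M)$. $Y$ determines, and is determined by, the non-empty closed subspace, also denoted $Y$, for which $\mathrm{Mod}\,Y$ is the full subcategory of those $M$ such that the natural map $M(-Y)\to M$ is zero. A closed subspace of a space is called an effective divisor if it arises in this way. For the closed subspace $Y$, $o_Y$ is the bimodule with $\mathcal{H}om_X(o_Y,-)=i_*i^!$; for the weakly closed subspace $W$, $o_W$ also denotes the weak $X$-$X$-bimodule with $\mathcal{H}om_X(o_W,-)=\alpha_*\alpha^!$. The weak bimodule $\mathcal{T}\!or^X_1(o_Y,o_W)$ is defined by $\mathcal{H}om_X(\mathcal{T}\!or^X_1(o_Y,o_W),E)=\mathcal{E}xt^1_X(o_Y,\mathcal{H}om_X(o_W,E))$ for injective $X$-modules $E$. *)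

(* Defs.v *)
From mathcomp Require Import all_boot all_algebra.

Set Implicit Arguments.
Unset Strict Implicit.
Unset Printing Implicit Defensive.

Import GRing.Theory.
Local Open Scope ring_scope.

Declare Scope cat_scope.
Delimit Scope cat_scope with cat.

(* Categories are preadditive; additivity of functors is imposed only in
   [left_exact]. *)
Record category := Category {
  Ob :> Type;
  Hom : Ob -> Ob -> zmodType;
  idm : forall A, Hom A A;
  comp : forall A B C, Hom B C -> Hom A B -> Hom A C;
  compA : forall A B C D (h : Hom C D) (g : Hom B C) (f : Hom A B),
    comp h (comp g f) = comp (comp h g) f;
  comp1m : forall A B (f : Hom A B), comp (idm B) f = f;
  compm1 : forall A B (f : Hom A B), comp f (idm A) = f;
  compDl : forall A B C (g g' : Hom B C) (f : Hom A B),
    comp (g + g') f = comp g f + comp g' f;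
  compDr : forall A B C (g : Hom B C) (f f' : Hom A B),
    comp g (f + f') = comp g f + comp g f' }.

Arguments Hom {c} A B.
Arguments idm {c} A.
Arguments comp {c A B C} g f.

Notation "g ∘ f" := (comp g f) (at level 40, left associativity) : cat_scope.
Local Open Scope cat_scope.

Record functor (C D : category) := Functor {
  fob :> C -> D;
  fmap : forall A B : C, Hom A B -> Hom (fob A) (fob B);
  fmap1 : forall A, fmap (idm A) = idm (fob A);
  fmapM : forall A B E (g : Hom B E) (f : Hom A B),
    fmap (g ∘ f) = fmap g ∘ fmap f }.

Arguments fmap {C D} f {A B} _ : rename.

Definition idF (C : category) : functor C C.
Proof. by exists id (fun A B f => f). Defined.

Definition compF (C D E : category) (G : functor D E) (F : functor C D) :
  functor C E.
Proof.
exists (fun A => G (F A)) (fun A B f => fmap G (fmap F f)).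
- by move=> A; rewrite !fmap1.
- by move=> A B K g f; rewrite !fmapM.
Defined.

Record nat_trans (C D : category) (F G : functor C D) := NatTrans {
  ncomp :> forall A : C, Hom (F A) (G A);
  ncompE : forall (A B : C) (f : Hom A B),
    ncomp B ∘ fmap F f = fmap G f ∘ ncomp A }.

Definition is_iso (C : category) (A B : C) (f : Hom A B) : Prop :=
  exists g : Hom B A, g ∘ f = idm A /\ f ∘ g = idm B.

Definition nat_isomorphism (C D : category) (F G : functor C D)
  (t : nat_trans F G) : Prop := forall A, is_iso (t A).

Definition nat_isomorphic (C D : category) (F G : functor C D) : Prop :=
  exists t : nat_trans F G, nat_isomorphism t.

Definition is_equivalence (C D : category) (F : functor C D) : Prop :=
  exists G : functor D C,
    nat_isomorphic (compF G F) (idF C) /\ nat_isomorphic (compF F G) (idF D).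

(* [adjunction L R] : L is left adjoint to R *)
Record adjunction (C D : category) (L : functor C D) (R : functor D C) :=
  Adjunction {
  adj_unit : nat_trans (idF C) (compF R L);
  adj_counit : nat_trans (compF L R) (idF D);
  adj_triL : forall A : C, adj_counit (L A) ∘ fmap L (adj_unit A) = idm (L A);
  adj_triR : forall B : D,
    fmap R (adj_counit B) ∘ adj_unit (R B) = idm (R B) }.

Definition mono (C : category) (A B : C) (m : Hom A B) : Prop :=
  forall (T : C) (f g : Hom T A), m ∘ f = m ∘ g -> f = g.

Definition epi (C : category) (A B : C) (e : Hom A B) : Prop :=
  forall (T : C) (f g : Hom B T), f ∘ e = g ∘ e -> f = g.

Definition is_zero (C : category) (Z : C) : Prop :=
  forall A : C, (forall f : Hom A Z, f = 0) /\ (forall f : Hom Z A, f = 0).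

Definition is_kernel (C : category) (K A B : C) (f : Hom A B) (k : Hom K A) :
  Prop :=
  f ∘ k = 0 /\
  forall (T : C) (h : Hom T A), f ∘ h = 0 -> exists! h' : Hom T K, k ∘ h' = h.

Definition is_cokernel (C : category) (A B Q : C) (f : Hom A B) (q : Hom B Q) :
  Prop :=
  q ∘ f = 0 /\
  forall (T : C) (h : Hom B T), h ∘ f = 0 -> exists! h' : Hom Q T, h' ∘ q = h.

Definition is_biproduct (C : category) (A B S : C) (i1 : Hom A S)
  (i2 : Hom B S) (p1 : Hom S A) (p2 : Hom S B) : Prop :=
  [/\ p1 ∘ i1 = idm A, p2 ∘ i2 = idm B, p1 ∘ i2 = 0, p2 ∘ i1 = 0
    & i1 ∘ p1 + i2 ∘ p2 = idm S].

Record is_abelian (C : category) : Prop := IsAbelian {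
  ab_zero : exists Z : C, is_zero Z;
  ab_biproduct : forall A B : C, exists (S : C) (i1 : Hom A S) (i2 : Hom B S)
    (p1 : Hom S A) (p2 : Hom S B), is_biproduct i1 i2 p1 p2;
  ab_kernel : forall (A B : C) (f : Hom A B),
    exists (K : C) (k : Hom K A), is_kernel f k;
  ab_cokernel : forall (A B : C) (f : Hom A B),
    exists (Q : C) (q : Hom B Q), is_cokernel f q;
  ab_mono_normal : forall (A B : C) (m : Hom A B), mono m ->
    exists (Q : C) (q : Hom B Q), is_kernel q m;
  ab_epi_normal : forall (A B : C) (e : Hom A B), epi e ->
    exists (K : C) (k : Hom K A), is_cokernel k e }.

(* The universe of the carriers of the groups [Hom A B].  A larger universe of
   index types would force a category with coproducts to be trivial. *)
Notation small := Type@{Algebra.Zmodule.axioms_.u0} (only parsing).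

Definition is_coproduct (C : category) (I : small) (A : I -> C) (S : C)
  (inj : forall i, Hom (A i) S) : Prop :=
  forall (T : C) (f : forall i, Hom (A i) T),
    exists! h : Hom S T, forall i, h ∘ inj i = f i.

Definition directed (I : small) (le : I -> I -> Prop) : Prop :=
  [/\ inhabited I, forall i, le i i,
      forall i j k, le i j -> le j k -> le i k
    & forall i j, exists k, le i k /\ le j k].

Record direct_system (C : category) (I : small) (le : I -> I -> Prop) :=
  DirectSystem {
  ds :> I -> C;
  ds_map : forall i j, le i j -> Hom (ds i) (ds j);
  ds_map1 : forall i (p : le i i), ds_map p = idm (ds i);
  ds_mapM : forall i j k (p : le i j) (q : le j k) (r : le i k),
    ds_map q ∘ ds_map p = ds_map r }.

Definition system_map (C : category) (I : small) (le : I -> I -> Prop)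
  (A B : direct_system C le) (f : forall i, Hom (A i) (B i)) : Prop :=
  forall i j (p : le i j), f j ∘ ds_map A p = ds_map B p ∘ f i.

Definition is_cocone (C : category) (I : small) (le : I -> I -> Prop)
  (A : direct_system C le) (L : C) (c : forall i, Hom (A i) L) : Prop :=
  forall i j (p : le i j), c j ∘ ds_map A p = c i.

Definition is_direct_limit (C : category) (I : small) (le : I -> I -> Prop)
  (A : direct_system C le) (L : C) (c : forall i, Hom (A i) L) : Prop :=
  is_cocone c /\
  forall (T : C) (f : forall i, Hom (A i) T), is_cocone f ->
    exists! h : Hom L T, forall i, h ∘ c i = f i.

Definition short_exact (C : category) (A B E : C) (f : Hom A B) (g : Hom B E) :
  Prop := is_kernel g f /\ is_cokernel f g.

Definition exact_direct_limits (C : category) : Prop :=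
  forall (I : small) (le : I -> I -> Prop), directed le ->
  forall (A B E : direct_system C le)
    (f : forall i, Hom (A i) (B i)) (g : forall i, Hom (B i) (E i)),
  system_map f -> system_map g -> (forall i, short_exact (f i) (g i)) ->
  forall (LA LB LE : C) (a : forall i, Hom (A i) LA)
    (b : forall i, Hom (B i) LB) (e : forall i, Hom (E i) LE),
  is_direct_limit a -> is_direct_limit b -> is_direct_limit e ->
  forall (lf : Hom LA LB) (lg : Hom LB LE),
  (forall i, lf ∘ a i = b i ∘ f i) -> (forall i, lg ∘ b i = e i ∘ g i) ->
  short_exact lf lg.

Definition is_generator (C : category) (G : C) : Prop :=
  forall (A B : C) (f g : Hom A B),
    (forall h : Hom G A, f ∘ h = g ∘ h) -> f = g.

Record is_grothendieck (C : category) : Prop := IsGrothendieck {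
  gr_abelian : is_abelian C;
  gr_coproduct : forall (I : small) (A : I -> C),
    exists (S : C) (inj : forall i, Hom (A i) S), is_coproduct inj;
  gr_exact_limits : exact_direct_limits C;
  gr_generator : exists G : C, is_generator G }.

(* The space X is identified with the category Mod X. *)
Record space := Space {
  Mod :> category;
  space_grothendieck : is_grothendieck Mod }.

Definition injective (C : category) (E : C) : Prop :=
  forall (A B : C) (m : Hom A B), mono m ->
  forall f : Hom A E, exists g : Hom B E, g ∘ m = f.

Definition left_exact (C D : category) (F : functor C D) : Prop :=
  (forall (A B : C) (f g : Hom A B), fmap F (f + g) = fmap F f + fmap F g) /\
  (forall (K A B : C) (f : Hom A B) (k : Hom K A),
     is_kernel f k -> is_kernel (fmap F f) (fmap F k)).

(* Im f = Ker g: the corestriction of f to any kernel of g is epi *)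
Definition exact (C : category) (A B E : C) (f : Hom A B) (g : Hom B E) :
  Prop :=
  g ∘ f = 0 /\
  forall (K : C) (k : Hom K B), is_kernel g k ->
  forall h : Hom A K, k ∘ h = f -> epi h.

Record injective_resolution (C : category) (M : C) := InjectiveResolution {
  res :> nat -> C;
  res_d : forall n, Hom (res n) (res n.+1);
  res_aug : Hom M (res 0);
  res_injective : forall n, injective (res n);
  res_aug_kernel : is_kernel (res_d 0) res_aug;
  res_exact : forall n, exact (res_d n) (res_d n.+1) }.

(* the differential into degree n, which is zero for n = 0 *)
Definition res_in (C : category) (M : C) (R : injective_resolution M) (n : nat) :
  Hom (R n.-1) (R n) :=
  match n return Hom (R n.-1) (R n) with
  | 0 => 0
  | m.+1 => res_d R m
  end.

(* H presented as the n-th cohomology Ker / Im of the complex F(R) *)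
Record cohomology (C D : category) (F : functor C D) (M : C)
  (R : injective_resolution M) (n : nat) (H : D) := Cohomology {
  cocycles : D;
  cocycles_in : Hom cocycles (F (R n));
  coboundaries : Hom (F (R n.-1)) cocycles;
  cocycles_class : Hom cocycles H;
  cocycles_kernel : is_kernel (fmap F (res_d R n)) cocycles_in;
  coboundariesE : cocycles_in ∘ coboundaries = fmap F (res_in R n);
  class_cokernel : is_cokernel coboundaries cocycles_class }.

Record resolution_map (C : category) (M M' : C) (f : Hom M M')
  (R : injective_resolution M) (R' : injective_resolution M') :=
  ResolutionMap {
  rmap :> forall n, Hom (R n) (R' n);
  rmap_aug : rmap 0 ∘ res_aug R = res_aug R' ∘ f;
  rmap_d : forall n, rmap n.+1 ∘ res_d R n = res_d R' n ∘ rmap n }.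

(* G = R^n F: the values of G are the cohomology objects H^n(F(R)), for every
   injective resolution R, and G f is the map induced on cohomology by any map
   of resolutions lifting f *)
Definition is_right_derived (C D : category) (F : functor C D) (n : nat)
  (G : functor C D) : Prop :=
  exists H : forall (M : C) (R : injective_resolution M),
    cohomology F R n (G M),
  forall (M M' : C) (f : Hom M M') (R : injective_resolution M)
    (R' : injective_resolution M') (r : resolution_map f R R')
    (z : Hom (cocycles (H M R)) (cocycles (H M' R'))),
  cocycles_in (H M' R') ∘ z = fmap F (r n) ∘ cocycles_in (H M R) ->
  cocycles_class (H M' R') ∘ z = fmap G f ∘ cocycles_class (H M R).

Definition full_sub (C : category) (P : C -> Prop) : category.
Proof.
exists {A : C | P A} (fun A B => Hom (sval A) (sval B))
  (fun A => idm (sval A)) (fun A B E g f => g ∘ f).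
- by move=> *; apply: compA.
- by move=> *; apply: comp1m.
- by move=> *; apply: compm1.
- by move=> *; apply: compDl.
- by move=> *; apply: compDr.
Defined.

Definition incl (C : category) (P : C -> Prop) : functor (full_sub P) C.
Proof. by exists (fun A => sval A) (fun A B f => f). Defined.

Record weakly_closed_subspace (C : category) := WeaklyClosed {
  wc_mod :> C -> Prop;
  wc_sub : forall (A B : C) (m : Hom A B), mono m -> wc_mod B -> wc_mod A;
  wc_quo : forall (A B : C) (e : Hom A B), epi e -> wc_mod A -> wc_mod B;
  shriek : functor C (full_sub wc_mod);
  shriek_adj : adjunction (incl wc_mod) shriek }.

Definition ModW (C : category) (W : weakly_closed_subspace C) : category :=
  full_sub W.

(* [direct_image W] is alpha_* and [shriek W] is alpha^! *)
Definition direct_image (C : category) (W : weakly_closed_subspace C) :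
  functor (ModW W) C := incl W.

(* [inverse_image Y] is i^* *)
Record closed_subspace (C : category) := ClosedSubspace {
  closed_wc :> weakly_closed_subspace C;
  inverse_image : functor C (ModW closed_wc);
  inverse_image_adj : adjunction inverse_image (direct_image closed_wc) }.

Definition empty_subspace (C : category) (W : weakly_closed_subspace C) : Prop :=
  forall M : ModW W, is_zero M.

Lemma adj_transposeR (C D : category) (L : functor C D) (R : functor D C)
  (a : adjunction L R) (A : C) (B : D) (h : Hom A (R B)) :
  h = fmap R (adj_counit a B ∘ fmap L h) ∘ adj_unit a A.
Proof.
have nat_h : adj_unit a (R B) ∘ h = fmap R (fmap L h) ∘ adj_unit a A.
  exact: (ncompE (adj_unit a) h).
by rewrite fmapM -compA -nat_h compA adj_triR comp1m.
Qed.

Lemma adj_transposeL (C D : category) (L : functor C D) (R : functor D C)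
  (a : adjunction L R) (A : C) (B : D) (h : Hom (L A) B) :
  h = adj_counit a B ∘ fmap L (fmap R h ∘ adj_unit a A).
Proof.
have nat_h : adj_counit a B ∘ fmap L (fmap R h) = h ∘ adj_counit a (L A).
  exact: (ncompE (adj_counit a) h).
by rewrite fmapM compA nat_h -compA adj_triL compm1.
Qed.

Section Auxiliary.
Variable C : category.

Lemma comp0m (A B E : C) (f : Hom A B) : (0 : Hom B E) ∘ f = 0.
Proof. by apply: (@addrI _ (0 ∘ f)); rewrite -compDl !addr0. Qed.

Lemma compm0 (A B E : C) (g : Hom B E) : g ∘ (0 : Hom A B) = 0.
Proof. by apply: (@addrI _ (g ∘ 0)); rewrite -compDr !addr0. Qed.

Lemma compNm (A B E : C) (g : Hom B E) (f : Hom A B) : (- g) ∘ f = - (g ∘ f).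
Proof. by apply: (@addrI _ (g ∘ f)); rewrite -compDl !subrr comp0m. Qed.

Lemma compmN (A B E : C) (g : Hom B E) (f : Hom A B) : g ∘ (- f) = - (g ∘ f).
Proof. by apply: (@addrI _ (g ∘ f)); rewrite -compDr !subrr compm0. Qed.

Lemma mono0P (A B : C) (m : Hom A B) :
  (forall T (f : Hom T A), m ∘ f = 0 -> f = 0) -> mono m.
Proof.
move=> m0 T f g e; apply/eqP; rewrite -subr_eq0; apply/eqP; apply: m0.
by rewrite compDr compmN e subrr.
Qed.

Lemma epi0P (A B : C) (m : Hom A B) :
  (forall T (f : Hom B T), f ∘ m = 0 -> f = 0) -> epi m.
Proof.
move=> m0 T f g e; apply/eqP; rewrite -subr_eq0; apply/eqP; apply: m0.
by rewrite compDl compNm e subrr.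
Qed.

Lemma kernel_mono (K A B : C) (f : Hom A B) (k : Hom K A) :
  is_kernel f k -> mono k.
Proof.
move=> [fk0 ku] T g h e.
have /ku [x [_ xu]] : f ∘ (k ∘ h) = 0 by rewrite compA fk0 comp0m.
by rewrite -(xu g) // (xu h).
Qed.

Lemma cokernel_epi (A B Q : C) (f : Hom A B) (q : Hom B Q) :
  is_cokernel f q -> epi q.
Proof.
move=> [qf0 qu] T g h e.
have /qu [x [_ xu]] : (h ∘ q) ∘ f = 0 by rewrite -compA qf0 compm0.
by rewrite -(xu g) // (xu h).
Qed.

Section WeaklyClosed.
Hypothesis abC : is_abelian C.
Variable W : weakly_closed_subspace C.

Lemma mono_direct_image (A B : ModW W) (m : Hom A B) :
  mono m -> mono (m : @Hom C (sval A) (sval B)).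
Proof.
move=> mm; apply: mono0P => T f mf0.
have [K [k [mk0 ku]]] := ab_kernel abC (m : @Hom C (sval A) (sval B)).
have WK : W K := wc_sub (kernel_mono (conj mk0 ku)) (proj2_sig A).
have k0 : k = 0.
  apply: (mm (exist _ K WK) k 0).
  by apply: (etrans (mk0)); apply: (esym (compm0 _ _)).
by have [h [<- _]] := ku _ _ mf0; rewrite k0 comp0m.
Qed.

Lemma epi_direct_image (A B : ModW W) (e : Hom A B) :
  epi e -> epi (e : @Hom C (sval A) (sval B)).
Proof.
move=> ee; apply: epi0P => T f fe0.
have [K [k [ke0 ku]]] := ab_cokernel abC (e : @Hom C (sval A) (sval B)).
have WK : W K := wc_quo (cokernel_epi (conj ke0 ku)) (proj2_sig B).
have k0 : k = 0.
  apply: (ee (exist _ K WK) k 0).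
  by apply: (etrans (ke0)); apply: (esym (comp0m _ _)).
by have [h [<- _]] := ku _ _ fe0; rewrite k0 compm0.
Qed.

Let eps (M : C) : Hom (sval (shriek W M)) M := adj_counit (shriek_adj W) M.

Lemma counit_nat (M N : C) (f : Hom M N) :
  eps N ∘ (fmap (shriek W) f : @Hom C _ _) = f ∘ eps M.
Proof. exact: (ncompE (adj_counit (shriek_adj W)) f). Qed.

Lemma shriek_factor (A : ModW W) (M : C) (f : @Hom C (sval A) M) :
  exists h : @Hom C (sval A) (sval (shriek W M)), eps M ∘ h = f.
Proof.
exists ((fmap (shriek W) f : @Hom C _ _) ∘ adj_unit (shriek_adj W) A).
by rewrite compA counit_nat -compA (adj_triL (shriek_adj W) A) compm1.
Qed.

Lemma shriek_inj (A : ModW W) (M : C) (f g : @Hom C (sval A) (sval (shriek W M))) :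
  eps M ∘ f = eps M ∘ g -> f = g.
Proof.
have E (h : @Hom C (sval A) (sval (shriek W M))) :
    h = (fmap (shriek W) (eps M ∘ h) : @Hom C _ _) ∘ adj_unit (shriek_adj W) A.
  exact: (adj_transposeR (shriek_adj W) (h : @Hom (ModW W) A (shriek W M))).
by move=> e; rewrite (E f) (E g) e.
Qed.

Lemma counit_mono (M : C) : mono (eps M).
Proof.
apply: mono0P => T f ef0.
have [K [k [ek0 ku]]] := ab_kernel abC (eps M).
have WK : W K := wc_sub (kernel_mono (conj ek0 ku)) (proj2_sig (shriek W M)).
have k0 : k = 0.
  by apply: (@shriek_inj (exist _ K WK)); rewrite ek0 compm0.
by have [h [<- _]] := ku _ _ ef0; rewrite k0 comp0m.
Qed.

Lemma shriek_left_exact :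
  left_exact (compF (direct_image W) (shriek W)).
Proof.
split=> [A B f g|K A B f k [fk0 ku]].
  apply: (@shriek_inj (shriek W A)).
  by rewrite [LHS]counit_nat compDl compDr; congr (_ + _); rewrite -counit_nat.
have kK : mono (fmap (compF (direct_image W) (shriek W)) k).
  move=> T g h e; apply: (@counit_mono K); apply: (kernel_mono (conj fk0 ku)).
  by rewrite !compA -!counit_nat -!compA; congr (_ ∘ _).
split.
  apply: (@shriek_inj (shriek W K)).
  rewrite compA [X in X ∘ _]counit_nat -compA [X in _ ∘ X]counit_nat.
  by rewrite compA fk0 comp0m compm0.
move=> T h fh0.
set af : @Hom C _ _ := fmap _ f in fh0.
have [K' [k' [fk' ku']]] := ab_kernel abC af.
have WK' : W K' := wc_sub (kernel_mono (conj fk' ku')) (proj2_sig (shriek W A)).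
have /ku [s [sE _]] : f ∘ (eps A ∘ k') = 0.
  by rewrite compA -counit_nat -compA fk' compm0.
have [u uE] := @shriek_factor (exist _ K' WK') K s.
have E : fmap (compF (direct_image W) (shriek W)) k ∘ u = k'.
  apply: (@counit_mono A).
  by rewrite compA [X in X ∘ _]counit_nat -compA uE sE.
have [v [vE _]] := ku' _ _ fh0.
exists (u ∘ v); split; first by rewrite compA E vE.
by move=> w wE; apply: kK; rewrite wE compA E vE.
Qed.

End WeaklyClosed.
End Auxiliary.

Section Cap.
Variables (X : space) (W : weakly_closed_subspace X) (Y : closed_subspace X).

Let abX : is_abelian X := gr_abelian (space_grothendieck X).

Definition cap_mod (M : ModW W) : Prop := Y (sval M).

Lemma cap_sub (A B : ModW W) (m : Hom A B) :
  mono m -> cap_mod B -> cap_mod A.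
Proof. by move=> mm; apply: (wc_sub (mono_direct_image abX mm)). Qed.

Lemma cap_quo (A B : ModW W) (e : Hom A B) :
  epi e -> cap_mod A -> cap_mod B.
Proof. by move=> ee; apply: (wc_quo (epi_direct_image abX ee)). Qed.

Lemma shriek_W (M : ModW W) : W (sval (shriek Y (sval M))).
Proof. exact: (wc_sub (@counit_mono X abX Y (sval M)) (proj2_sig M)). Qed.

Lemma unit_epi (M : X) :
  epi (adj_unit (inverse_image_adj Y) M : @Hom X M (sval (inverse_image Y M))).
Proof.
set eta := adj_unit (inverse_image_adj Y).
apply: epi0P => T f fe0.
have [Q [q [qe0 qu]]] :=
  ab_cokernel abX (eta M : @Hom X M (sval (inverse_image Y M))).
have YQ : Y Q := wc_quo (cokernel_epi (conj qe0 qu))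
                        (proj2_sig (inverse_image Y M)).
pose Q' : ModW Y := exist _ Q YQ.
have E (h : @Hom (ModW Y) (inverse_image Y M) Q') :
    h = adj_counit (inverse_image_adj Y) Q' ∘
        fmap (inverse_image Y) ((h : @Hom X _ Q) ∘ eta M).
  exact: (adj_transposeL (inverse_image_adj Y) h).
have q0 : q = 0.
  by rewrite [LHS](E q) [RHS](E 0) qe0 comp0m.
by have [h [<- _]] := qu _ _ fe0; rewrite q0 compm0.
Qed.

Lemma inverse_image_W (M : ModW W) : W (sval (inverse_image Y (sval M))).
Proof. exact: (wc_quo (@unit_epi (sval M)) (proj2_sig M)). Qed.

Definition cap_shriek : functor (ModW W) (full_sub cap_mod).
Proof.
exists (fun M => exist cap_mod (exist W _ (shriek_W M))
                       (proj2_sig (shriek Y (sval M))))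
       (fun A B f => fmap (shriek Y) (f : @Hom X (sval A) (sval B))).
- by move=> A; apply: (fmap1 (shriek Y)).
- by move=> A B D g f; apply: (fmapM (shriek Y)).
Defined.

Definition in_Y (N : full_sub cap_mod) : ModW Y :=
  exist Y (sval (sval N)) (proj2_sig N).

Lemma shriek_unit_eta (N : ModW Y) :
  adj_unit (shriek_adj Y) (exist Y (sval N) (proj2_sig N)) =
  adj_unit (shriek_adj Y) N :> @Hom X (sval N) (sval (shriek Y (sval N))).
Proof. by case: N. Qed.

Lemma inverse_image_counit_eta (N : ModW Y) :
  adj_counit (inverse_image_adj Y) (exist Y (sval N) (proj2_sig N)) =
  adj_counit (inverse_image_adj Y) N
  :> @Hom X (sval (inverse_image Y (sval N))) (sval N).
Proof. by case: N. Qed.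

Definition cap_shriek_adj : adjunction (incl cap_mod) cap_shriek.
Proof.
pose a := shriek_adj Y.
pose u : nat_trans (idF _) (compF cap_shriek (incl cap_mod)) :=
  @NatTrans _ _ (idF (full_sub cap_mod))
    (compF cap_shriek (incl cap_mod))
    (fun N => adj_unit a (in_Y N))
    (fun A B f => ncompE (adj_unit a) (f : @Hom (ModW Y) (in_Y A) (in_Y B))).
pose c : nat_trans (compF (incl cap_mod) cap_shriek) (idF _) :=
  @NatTrans _ _ (compF (incl cap_mod) cap_shriek) (idF (ModW W))
    (fun M => adj_counit a (sval M))
    (fun A B f => ncompE (adj_counit a) (f : @Hom X (sval A) (sval B))).
exists u c.
- by move=> N; apply: (adj_triL a (in_Y N)).
- move=> M; apply: etrans (adj_triR a (sval M)).
  exact: (congr1 (fun h => comp (c := X) _ h)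
                 (shriek_unit_eta (shriek Y (sval M)))).
Defined.

Definition cap_wc : weakly_closed_subspace (ModW W) :=
  WeaklyClosed cap_sub cap_quo cap_shriek_adj.

Definition cap_inverse_image : functor (ModW W) (ModW cap_wc).
Proof.
exists (fun M => exist cap_mod (exist W _ (inverse_image_W M))
                       (proj2_sig (inverse_image Y (sval M))))
       (fun A B f => fmap (inverse_image Y) (f : @Hom X (sval A) (sval B))).
- by move=> A; apply: (fmap1 (inverse_image Y)).
- by move=> A B D g f; apply: (fmapM (inverse_image Y)).
Defined.

Definition cap_inverse_image_adj :
  adjunction cap_inverse_image (direct_image cap_wc).
Proof.
pose a := inverse_image_adj Y.
pose u : nat_trans (idF _) (compF (direct_image cap_wc) cap_inverse_image) :=
  @NatTrans _ _ (idF (ModW W))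
    (compF (direct_image cap_wc) cap_inverse_image)
    (fun M => adj_unit a (sval M))
    (fun A B f => ncompE (adj_unit a) (f : @Hom X (sval A) (sval B))).
pose c : nat_trans (compF cap_inverse_image (direct_image cap_wc)) (idF _) :=
  @NatTrans _ _ (compF cap_inverse_image (direct_image cap_wc))
    (idF (ModW cap_wc))
    (fun N => adj_counit a (in_Y N))
    (fun A B f => ncompE (adj_counit a) (f : @Hom (ModW Y) (in_Y A) (in_Y B))).
exists u c.
- move=> M; apply: etrans (adj_triL a (sval M)).
  exact: (congr1 (fun h => comp (c := X) h _)
                 (inverse_image_counit_eta (inverse_image Y (sval M)))).
- by move=> N; apply: (adj_triR a (in_Y N)).
Defined.

Definition cap : closed_subspace (ModW W) :=
  ClosedSubspace cap_inverse_image_adj.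

End Cap.

(* [hom_bimod B] is the functor Hom(B, -). *)
Record weak_bimodule (C : category) := WeakBimodule {
  hom_bimod :> functor C C;
  hom_left_exact : left_exact hom_bimod }.

(* Weak bimodules form the opposite of the category of left exact functors. *)
Definition bimod_hom (C : category) (B B' : weak_bimodule C) : Type :=
  nat_trans (hom_bimod B') (hom_bimod B).

Definition bimod_mono (C : category) (B B' : weak_bimodule C)
  (t : bimod_hom B B') : Prop :=
  forall E : C, injective E -> epi (t E).

Definition bimod_iso (C : category) (B B' : weak_bimodule C)
  (t : bimod_hom B B') : Prop := nat_isomorphism t.

Definition bimod_zero (C : category) (B : weak_bimodule C) : Prop :=
  forall M : C, is_zero (hom_bimod B M).

(* [tensor_bimod B] is the functor - ⊗ B. *)
Record bimodule (C : category) := Bimodule {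
  bimod_weak :> weak_bimodule C;
  tensor_bimod : functor C C;
  tensor_hom_adj : adjunction tensor_bimod (hom_bimod bimod_weak) }.

Definition invertible (C : category) (B : bimodule C) : Prop :=
  is_equivalence (hom_bimod B).

Lemma idF_left_exact (C : category) : left_exact (idF C).
Proof. by []. Qed.

Definition o_space (C : category) : weak_bimodule C :=
  WeakBimodule (idF_left_exact C).

Definition o_sub (X : space) (W : weakly_closed_subspace X) : weak_bimodule X :=
  WeakBimodule (shriek_left_exact (gr_abelian (space_grothendieck X)) W).

(* T = Tor_1(B, B'): Hom(T, E) = Ext^1(B, Hom(B', E)), naturally in the
   injective object E *)
Definition is_Tor1 (C : category) (B B' T : weak_bimodule C) : Prop :=
  exists Ext1 : functor C C,
    is_right_derived (hom_bimod B) 1 Ext1 /\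
    nat_isomorphic (compF (hom_bimod T) (incl (@injective C)))
      (compF (compF Ext1 (hom_bimod B')) (incl (@injective C))).

(* [div_bimod D] is o(-Y), and [div_map D] is its inclusion into o. *)
Record divisor (C : category) := Divisor {
  div_bimod : bimodule C;
  div_map : bimod_hom div_bimod (o_space C);
  div_invertible : invertible div_bimod;
  div_mono : bimod_mono div_map;
  div_proper : ~ bimod_iso div_map }.

(* M(Y) is [twist D M] and M(-Y) is [untwist D M]. *)
Definition twist (C : category) (D : divisor C) : functor C C :=
  hom_bimod (div_bimod D).

Definition untwist (C : category) (D : divisor C) : functor C C :=
  tensor_bimod (div_bimod D).

(* the map M(-Y) -> M adjoint to M -> M(Y) *)
Definition untwist_map (C : category) (D : divisor C) (M : C) :
  Hom (untwist D M) M :=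
  adj_counit (tensor_hom_adj (div_bimod D)) M ∘
  fmap (untwist D) (div_map D M : Hom M (twist D M)).

Definition arises_from (C : category) (Y : closed_subspace C) (D : divisor C) :
  Prop := forall M : C, Y M <-> untwist_map D M = 0.

Definition is_effective_divisor (C : category) (Y : closed_subspace C) : Prop :=
  exists D : divisor C, arises_from Y D.

(* Main.v *)
(* Write eta_M : M -> M(Y).  As M -> M(Y) is an exact autoequivalence,
   i_* i^! M = Ker eta_M, the condition i^* M = 0 means that eta_M is epi, and
   Ext^1(o_Y, M) = Coker eta_M.  Hence both the vanishing of Tor_1(o_Y, o_W) and
   that of i^* alpha_* alpha^! on injectives say that eta is epi on alpha^! E for
   every injective E.

   If W ∩ Y is an effective divisor on W, then alpha^! E, being injective in
   Mod W, has no nonzero quotient in Mod W ∩ Mod Y, so eta is epi on it.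
   Conversely, o_X(-Y) restricts to Mod W, and the restricted map to o_W is mono
   because every injective of Mod W is a retract of some alpha^! E.

   Both "injective resolutions exist" and the retract argument need enough
   injectives.  Following Eckmann-Schopf, fix a generator G and characters that
   separate the points of Hom(G, M).  They extend to Hom(G, N) for an essential
   extension N of M and embed it into a set that does not depend on N, so Zorn's
   lemma yields a maximal essential extension, which is injective. *)

From mathcomp Require Import all_boot all_order all_algebra all_field.
From Stdlib Require Import ClassicalEpsilon FunctionalExtensionality PropExtensionality.
Require Import Defs.

Set Implicit Arguments.
Unset Strict Implicit.
Unset Printing Implicit Defensive.

Import GRing.Theory Num.Theory.
Local Open Scope ring_scope.
Local Open Scope cat_scope.

(** * Zorn's lemma and characters of abelian groups *)

Lemma set_ext (T : Type) (A B : T -> Prop) :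
  (forall x, A x -> B x) -> (forall x, B x -> A x) -> A = B.
Proof.
move=> AB BA; apply: functional_extensionality => x.
by apply: propositional_extensionality; split; [apply: AB | apply: BA].
Qed.

Lemma choice_fun (A B : Type) (R : A -> B -> Prop) :
  (forall a, exists b, R a b) -> exists f : A -> B, forall a, R a (f a).
Proof.
move=> Rab.
exists (fun a => proj1_sig (constructive_indefinite_description _ (Rab a))).
by move=> a; case: constructive_indefinite_description.
Qed.

Section Tower.
Variables (T : Type) (next : (T -> Prop) -> T).

Let sub (A B : T -> Prop) := forall x, A x -> B x.
Let succ (A : T -> Prop) : T -> Prop := fun x => A x \/ x = next A.

(** The least family of subsets closed under unions and under adding the point [next A]; the union
    of the empty family starts it. It turns out to be a chain for inclusion. *)
Inductive tower : (T -> Prop) -> Prop :=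
| tower_union (F : (T -> Prop) -> Prop) :
    (forall A, F A -> tower A) -> tower (fun x => exists2 A, F A & A x)
| tower_succ A : tower A -> tower (succ A).

Let extreme (C : T -> Prop) :=
  forall A, tower A -> sub A C -> ~ sub C A -> sub (succ A) C.

(** Induction along the tower: extremality carries a proper subset of [C] at most to [C], so no
    member lies strictly between [C] and its successor. *)
Lemma extreme_cmp C : extreme C ->
  forall A, tower A -> sub A C \/ sub (succ C) A.
Proof.
move=> eC A; elim=> [F _ IH|{}A tA IH].
  have [[B FB CB]|nF] := classic (exists2 B, F B & sub (succ C) B).
    by right=> x /CB Bx; exists B.
  left=> x [B FB Bx]; case: (IH B FB) => [BC|CB]; first exact: BC.
  by case: nF; exists B.
case: IH => [AC|CA]; last by right=> x /CA; left.
have [CA|nCA] := classic (sub C A); last by left; apply: eC.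
by right; rewrite (set_ext AC CA).
Qed.

Lemma tower_extreme C : tower C -> extreme C.
Proof.
elim=> [F tF IH|{}C tC IH] A tA AC nCA.
  have [B FB nBA] : exists2 B, F B & ~ sub B A.
    apply: NNPP => nB; apply: nCA => x [B FB Bx].
    by apply: NNPP => nAx; apply: nB; exists B => // BA; apply/nAx/BA.
  have AB : sub A B.
    case: (extreme_cmp (IH B FB) tA) => // BA.
    by case: nBA => x Bx; apply: BA; left.
  by move=> x /(IH B FB A tA AB nBA) Bx; exists B.
case: (extreme_cmp IH tA) => // {}AC.
have [CA|nCA'] := classic (sub C A); first by rewrite (set_ext AC CA).
by move=> x /(IH A tA AC nCA'); left.
Qed.

Lemma tower_total A B : tower A -> tower B -> sub A B \/ sub B A.
Proof.
move=> tA tB; case: (extreme_cmp (tower_extreme tB) tA); first by left.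
by move=> BA; right=> x Bx; apply: BA; left.
Qed.

End Tower.

Definition chain (T : Type) (R : T -> T -> Prop) (A : T -> Prop) : Prop :=
  forall s t, A s -> A t -> R s t \/ R t s.

(* The Zorn lemma of mathcomp-classical would force the universe of the objects
   of a category below that of [small]. *)
Lemma zorn_preorder (T : Type) (R : T -> T -> Prop) :
  (forall t, R t t) -> (forall r s t, R r s -> R s t -> R r t) ->
  (forall A, chain R A -> exists t, forall s, A s -> R s t) ->
  exists t, forall s, R t s -> R s t.
Proof.
move=> Rxx Rtr ub; apply: NNPP => nmax.
(* Without a maximal element every chain has a bound strictly above all its members. A set that is
   not a chain gets an arbitrary value, the bound of the empty chain. *)
have ubs A : exists t, chain R A -> forall s, A s -> R s t /\ ~ R t s.
  have [cA|ncA] := classic (chain R A); last first.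
    have [|t _] := ub (fun _ => False); first by [].
    by exists t.
  have [t tP] := ub A cA.
  have [s [ts nst]] : exists s, R t s /\ ~ R s t.
    apply: NNPP => ns; apply: nmax; exists t => s ts; apply: NNPP => nst.
    by apply: ns; exists s.
  exists s => _ a Aa; split; first by apply: Rtr ts; apply: tP.
  by move=> sa; apply: nst; apply: Rtr sa _; apply: tP.
have [next nextP] := choice_fun ubs.
have tc A : tower next A -> chain R A.
  elim=> [F tF IH|{}A _ IH] s t.
    move=> [B FB Bs] [B' FB' Bt].
    case: (tower_total (tF B FB) (tF B' FB')) => BB.
      by apply: (IH B') => //; apply: BB.
    by apply: (IH B) => //; apply: BB.
  move=> [As|->] [At|->]; first exact: IH.
  - by left; case: (nextP A IH s As).
  - by right; case: (nextP A IH t At).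
  - by left.
(* The largest member of the tower contains its own strict upper bound [next U], which is absurd. *)
pose U x := exists2 A, tower next A & A x.
have tU : tower next U by apply: tower_union.
have Un : U (next U).
  by exists (fun x => U x \/ x = next U); [apply: tower_succ | right].
by case: (nextP U (tc U tU) _ Un).
Qed.

(** * Characters of abelian groups with values in the algebraic numbers *)

Section Characters.
Variable B : zmodType.

(** The nonzero elements of [algC] form a divisible group with elements of every finite order, so
    they can play the role of Q/Z. The equation at [x = y] forces all values to be nonzero. *)
Definition is_char (chi : B -> algC) : Prop :=
  chi 0 = 1 /\ forall x y, chi (x - y) = chi x / chi y.

(* The graph of a character of a subgroup of B. *)
Definition partial_char (g : B -> algC -> Prop) : Prop :=
  [/\ g 0 1, forall x y u v, g x u -> g y v -> g (x - y) (u / v)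
    & forall u, g 0 u -> u = 1].

Section Partial.
Variables (g : B -> algC -> Prop) (gP : partial_char g).

Lemma partial_char_neq0 x u : g x u -> u != 0.
Proof.
case: gP => _ gB g0 gxu; apply/eqP => u0.
(* Since [0 / 0] is 0 by convention, a zero value would give 0 the value 0 instead of 1. *)
have := gB _ _ _ _ gxu gxu; rewrite subrr => /g0; rewrite u0 mul0r.
by move/eqP; rewrite eq_sym oner_eq0.
Qed.

Lemma partial_char_fun x u v : g x u -> g x v -> u = v.
Proof.
case: (gP) => _ gB g0 gxu gxv.
have := gB _ _ _ _ gxu gxv; rewrite subrr => /g0 e.
by rewrite -[u](divfK (partial_char_neq0 gxv)) e mul1r.
Qed.

Lemma partial_charN x u : g x u -> g (- x) u^-1.
Proof.
by case: gP => g1 gB _ gxu; have := gB _ _ _ _ g1 gxu; rewrite sub0r mul1r.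
Qed.

Lemma partial_charD x y u v : g x u -> g y v -> g (x + y) (u * v).
Proof.
case: (gP) => _ gB _ gxu /partial_charN gyv.
by have := gB _ _ _ _ gxu gyv; rewrite opprK invrK.
Qed.

Lemma partial_charMn x u n : g x u -> g (x *+ n) (u ^+ n).
Proof.
move=> gxu; elim: n => [|n IH]; first by rewrite mulr0n expr0; case: gP.
by rewrite mulrS exprS; apply: partial_charD.
Qed.

Lemma partial_charMz x u n : g x u -> g (x *~ n) (u ^ n).
Proof.
move=> gxu; case: n => n; first exact: partial_charMn.
exact: partial_charN (partial_charMn _ gxu).
Qed.

(** If no positive multiple of [x] lies in the domain, the value at [x] is free. Otherwise the
    multiples in the domain are those of a least [n], and [w] is an n-th root of the value there.
    The clause [w != 1] serves to separate points. *)
Lemma partial_char_root x : exists w : algC,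
  [/\ w != 0, forall n u, g (x *~ n) u -> u = w ^ n & ~ g x 1 -> w != 1].
Proof.
have [[n0 [n0_gt0 dn0]]|nodom] :=
    classic (exists n, (0 < n)%N /\ exists u, g (x *+ n) u); last first.
  (* Any number other than 0 and 1 would do. *)
  exists 2; split=> [|n u gu|_]; first by rewrite pnatr_eq0.
    case: n gu => [[|n]|n] gu; first by case: gP => _ _ g0; apply: g0.
      by case: nodom; exists n.+1; split=> //; exists u.
    case: nodom; exists n.+1; split=> //; exists u^-1.
    by have := partial_charN gu; rewrite NegzE mulrNz opprK.
  by rewrite -subr_eq0 (_ : 2 - 1 = 1) ?oner_eq0 // mulr2n addrK.
have [n [n_gt0 [u gu] nmin]] : exists n, [/\ (0 < n)%N, exists u, g (x *+ n) u
    & forall m, (0 < m)%N -> (exists u, g (x *+ m) u) -> (n <= m)%N].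
  elim/ltn_ind: n0 n0_gt0 dn0 => n IH n_gt0 dn.
  have [[m [m_gt0 dm mn]]|nm] := classic
      (exists m, [/\ (0 < m)%N, exists u, g (x *+ m) u & (m < n)%N]).
    exact: (IH m).
  exists n; split=> // m m_gt0 dm; rewrite leqNgt; apply/negP => mn.
  by apply: nm; exists m.
have [w [wn w1]] : exists w : algC, w ^+ n = u /\ (~ g x 1 -> w != 1).
  pose w : algC := n.-root u.
  have wn : w ^+ n = u by apply: rootCK.
  have [w1|/eqP w1] := eqVneq w 1; last by exists w; split=> // _; apply/eqP.
  have u1 : u = 1 by rewrite -wn w1 expr1n.
  (* The chosen root is 1, so the value at [x *+ n] is 1. A primitive n-th root of unity then
     replaces it, unless [n = 1], where [x] itself already has value 1. *)
  have [n1|n1] := eqVneq n 1%N.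
    by exists w; split=> // -[]; rewrite -u1; move: gu; rewrite n1.
  have [z zP] := C_prim_root_exists n_gt0.
  exists z; split=> [|_]; first by rewrite (prim_expr_order zP).
  apply: contra_neq n1 => z1; apply/eqP; rewrite -dvdn1.
  by rewrite (prim_order_dvd zP) expr1 z1.
have w0 : w != 0.
  apply: contraTneq (partial_char_neq0 gu) => w0.
  by rewrite -wn w0 expr0n eqn0Ngt n_gt0 eqxx.
exists w; split=> // m v gv.
have wz : w ^ n = u by [].
(* Euclidean division by [n]: the remainder gives a multiple of [x] in the domain, so minimality of
   [n] makes it 0. *)
have gq : g (x *~ ((m %/ n)%Z * n)) (u ^ (m %/ n)%Z).
  by rewrite mulrC mulrzA; apply: partial_charMz.
have gr : g (x *~ (m %% n)%Z) (v / u ^ (m %/ n)%Z).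
  rewrite (_ : x *~ _ = x *~ m - x *~ ((m %/ n)%Z * n)).
    by case: gP => _ gB _; apply: gB.
  by rewrite -mulrzBr {2}(divz_eq m n) addrAC subrr add0r.
have nz : (n : int) != 0 by rewrite -lt0n in n_gt0 *; case: (n) n_gt0.
have r0 : (m %% n)%Z = 0.
  have r_ge0 := modz_ge0 m nz.
  have r_lt : ((m %% n)%Z < n)%R by apply: ltz_pmod.
  case: (m %% n)%Z gr r_ge0 r_lt => // -[//|r] gr _ rn.
  have nr : (n <= r.+1)%N by apply: nmin => //; exists (v / u ^ (m %/ n)%Z).
  by have := leq_ltn_trans nr rn; rewrite ltnn.
move: gr; rewrite r0 mulr0z => gr.
have /divr1_eq -> : v / u ^ (m %/ n)%Z = 1 by case: gP => _ _; apply.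
by rewrite {2}(divz_eq m n) r0 addr0 mulrC -exprz_exp wz.
Qed.

End Partial.

Lemma partial_char_extend (g : B -> algC -> Prop) x w : partial_char g ->
  w != 0 -> (forall n u, g (x *~ n) u -> u = w ^ n) ->
  partial_char (fun y v => exists z u n,
    [/\ g z u, y = z + x *~ n & v = u * w ^ n]).
Proof.
move=> gP w0 gw; have [g1 gB g0] := gP; split.
- by exists 0, 1, 0; rewrite mulr0z addr0 expr0z mulr1.
- move=> _ _ _ _ [z [u [n [gz -> ->]]]] [z' [u' [n' [gz' -> ->]]]].
  exists (z - z'), (u / u'), (n - n'); split; first exact: gB.
    by rewrite mulrzBr opprD addrACA.
  by rewrite expfzDr // -invr_expz invfM mulrACA.
move=> _ [z [u [n [gz e ->]]]].
have {}e : z = x *~ - n by rewrite mulrNz; apply/eqP; rewrite -addr_eq0 -e.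
move: gz; rewrite e => /gw ->; rewrite -expfzDr // addNr expr0z //.
Qed.

(** Injectivity of the multiplicative group of [algC]: a maximal extension of [g] is total, because
    [partial_char_root] provides a value at any further element. *)
Lemma char_extension (g : B -> algC -> Prop) : partial_char g ->
  exists2 chi, is_char chi & forall x u, g x u -> chi x = u.
Proof.
move=> gP.
pose T := {h : B -> algC -> Prop | partial_char h /\ forall x u, g x u -> h x u}.
pose R (h k : T) := forall x u, sval h x u -> sval k x u.
have [||A cA|[h [hP gh]] hmax] := @zorn_preorder T R.
- by move=> h x u.
- by move=> h k l hk kl x u /hk/kl.
- have [[h0 Ah0]|nA] := classic (exists h, A h); last first.
    by exists (exist _ g (conj gP (fun x u H => H))) => s As; case: nA; exists s.
  pose k x u := exists2 h, A h & sval h x u.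
  have kP : partial_char k.
    split; first by exists h0 => //; case: (svalP h0) => [] [].
      move=> x y u v [h Ah hx] [h' Ah' hy].
      case: (cA h h' Ah Ah') => hh.
        by exists h' => //; case: (svalP h') => -[_ h'B _] _; apply: h'B => //; apply: hh.
      by exists h => //; case: (svalP h) => -[_ hB _] _; apply: hB => //; apply: hh.
    by move=> u [h Ah hu]; case: (svalP h) => -[_ _ h0'] _; apply: h0'.
  have gk x u : g x u -> k x u.
    by move=> gxu; exists h0 => //; case: (svalP h0) => _; apply.
  by exists (exist _ k (conj kP gk)) => h Ah x u hxu; exists h.
have tot x : exists u, h x u.
  have [w [w0 hw _]] := partial_char_root hP x.
  have kP := partial_char_extend hP w0 hw.
  set k := (fun _ _ => _) in kP.
  have hk y u : h y u -> k y u.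
    by exists y, u, 0; rewrite mulr0z addr0 expr0z mulr1.
  have := hmax (exist _ k (conj kP (fun y u gyu => hk y u (gh y u gyu)))) hk.
  move=> /(_ x w) /= hxw; exists w; apply: hxw.
  by exists 0, 1, 1; rewrite mulr1z add0r expr1z mul1r; case: (hP).
have [chi chiP] := choice_fun tot.
exists chi => [|x u gxu].
  split=> [|x y]; first by apply: (partial_char_fun hP (chiP 0)); case: (hP).
  by apply: (partial_char_fun hP (chiP _)); case: (hP) => _ + _; apply.
by apply: (partial_char_fun hP (chiP x) (gh _ _ gxu)).
Qed.

(** The trivial character of the zero subgroup leaves the value at [x] open, so it can be chosen
    different from 1. *)
Lemma char_separates (x : B) : x <> 0 -> exists2 chi, is_char chi & chi x <> 1.
Proof.
move=> x0; pose g (y : B) (u : algC) := y = 0 /\ u = 1.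
have gP : partial_char g.
  split=> // [|u [] //] y z u v [-> ->] [-> ->].
  by rewrite subrr divr1.
have [w [w0 gw w1]] := partial_char_root gP x.
have kP := partial_char_extend gP w0 gw.
have [chi chiP chiE] := char_extension kP.
exists chi => //; rewrite (chiE x w); first by apply/eqP/w1; case.
by exists 0, 1, 1; rewrite mulr1z add0r expr1z mul1r.
Qed.

End Characters.

(** * Abelian categories and direct limits *)

Section Preadditive.
Variable C : category.

Lemma compBm (A B E : C) (g g' : Hom B E) (f : Hom A B) :
  (g - g') ∘ f = g ∘ f - g' ∘ f.
Proof. by rewrite compDl compNm. Qed.

Lemma compmB (A B E : C) (g : Hom B E) (f f' : Hom A B) :
  g ∘ (f - f') = g ∘ f - g ∘ f'.
Proof. by rewrite compDr compmN. Qed.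

Lemma mono_eq0 (A B T : C) (m : Hom A B) (f : Hom T A) :
  mono m -> m ∘ f = 0 -> f = 0.
Proof. by move=> mm mf; apply: mm; rewrite compm0. Qed.

Lemma epi_eq0 (A B T : C) (e : Hom A B) (f : Hom B T) :
  epi e -> f ∘ e = 0 -> f = 0.
Proof. by move=> ee fe; apply: ee; rewrite comp0m. Qed.

Lemma mono_comp (A B E : C) (g : Hom B E) (f : Hom A B) :
  mono g -> mono f -> mono (g ∘ f).
Proof. by move=> mg mf T x y e; apply/mf/mg; rewrite !compA. Qed.

Lemma epi_comp (A B E : C) (g : Hom B E) (f : Hom A B) :
  epi g -> epi f -> epi (g ∘ f).
Proof. by move=> eg ef T x y e; apply/eg/ef; rewrite -!compA. Qed.

Lemma mono_compl (A B E : C) (g : Hom B E) (f : Hom A B) :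
  mono (g ∘ f) -> mono f.
Proof. by move=> mgf T x y e; apply: mgf; rewrite -!compA e. Qed.

Lemma epi_compr (A B E : C) (g : Hom B E) (f : Hom A B) :
  epi (g ∘ f) -> epi g.
Proof. by move=> egf T x y e; apply: egf; rewrite !compA e. Qed.

Lemma iso_mono (A B : C) (f : Hom A B) : is_iso f -> mono f.
Proof.
by case=> g [gf _]; apply: (@mono_compl _ _ _ g); rewrite gf => T x y; rewrite !comp1m.
Qed.

Lemma iso_epi (A B : C) (f : Hom A B) : is_iso f -> epi f.
Proof.
by case=> g [_ fg]; apply: (@epi_compr _ _ _ f g); rewrite fg => T x y; rewrite !compm1.
Qed.

Lemma kernel_lift (K A B T : C) (f : Hom A B) (k : Hom K A) (h : Hom T A) :
  is_kernel f k -> f ∘ h = 0 -> exists h', k ∘ h' = h.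
Proof. by case=> _ ku /ku [h' [e _]]; exists h'. Qed.

Lemma cokernel_lift (A B Q T : C) (f : Hom A B) (q : Hom B Q) (h : Hom B T) :
  is_cokernel f q -> h ∘ f = 0 -> exists h', h' ∘ q = h.
Proof. by case=> _ qu /qu [h' [e _]]; exists h'. Qed.

Lemma is_kernelP (K A B : C) (f : Hom A B) (k : Hom K A) :
  mono k -> f ∘ k = 0 ->
  (forall T (h : Hom T A), f ∘ h = 0 -> exists h', k ∘ h' = h) -> is_kernel f k.
Proof.
move=> mk fk kl; split=> // T h /kl [h' e]; exists h'; split=> // h'' e'.
by apply: mk; rewrite e.
Qed.

Lemma is_cokernelP (A B Q : C) (f : Hom A B) (q : Hom B Q) :
  epi q -> q ∘ f = 0 ->
  (forall T (h : Hom B T), h ∘ f = 0 -> exists h', h' ∘ q = h) ->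
  is_cokernel f q.
Proof.
move=> eq qf ql; split=> // T h /ql [h' e]; exists h'; split=> // h'' e'.
by apply: eq; rewrite e.
Qed.

Lemma is_zero_id (Z : C) : idm Z = 0 -> is_zero Z.
Proof.
by move=> z A; split=> f; [rewrite -[f]comp1m z comp0m | rewrite -[f]compm1 z compm0].
Qed.

End Preadditive.

Section Abelian.
Variables (C : category) (abC : is_abelian C).

Lemma mono_kernel_cokernel (A B Q : C) (m : Hom A B) (q : Hom B Q) :
  mono m -> is_cokernel m q -> is_kernel q m.
Proof.
move=> mm cq; have [Q' [q' kq']] := ab_mono_normal abC mm.
apply: is_kernelP => // [|T h qh]; first by case: cq.
have [s sE] := cokernel_lift cq (proj1 kq').
by apply: (kernel_lift kq'); rewrite -sE -compA qh compm0.
Qed.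

Lemma epi_cokernel_kernel (K A B : C) (e : Hom A B) (k : Hom K A) :
  epi e -> is_kernel e k -> is_cokernel k e.
Proof.
move=> ee kk; have [K' [k' kk']] := ab_epi_normal abC ee.
apply: is_cokernelP => // [|T h hk]; first by case: kk.
have [s sE] := kernel_lift kk (proj1 kk').
by apply: (cokernel_lift kk'); rewrite -sE compA hk comp0m.
Qed.

Lemma mono_epi_iso (A B : C) (f : Hom A B) : mono f -> epi f -> is_iso f.
Proof.
move=> mf ef; have [Q [q qf]] := ab_mono_normal abC mf.
have q0 : q = 0 by apply: (epi_eq0 ef); case: qf.
have [g fg] : exists g, f ∘ g = idm B.
  by apply: (kernel_lift qf); rewrite q0 comp0m.
by exists g; split=> //; apply: mf; rewrite compA fg comp1m compm1.
Qed.

(** The image is the kernel of the cokernel. If [g] kills [e] and [k] is the kernel of [g], then [f]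
    factors through [m ∘ k]; being itself a kernel, this subobject contains all of [m], so
    [g = 0]. *)
Lemma image_factor (A B : C) (f : Hom A B) :
  exists (I : C) (m : Hom I B) (e : Hom A I), [/\ mono m, epi e & m ∘ e = f].
Proof.
have [Q [q cq]] := ab_cokernel abC f.
have [I [m km]] := ab_kernel abC q.
have [e me] := kernel_lift km (proj1 cq).
have mm := kernel_mono km.
exists I, m, e; split=> //; apply: epi0P => T g ge.
have [K [k kk]] := ab_kernel abC g.
have mk := kernel_mono kk.
have [e' ke'] := kernel_lift kk ge.
have [Q2 [q2 kq2]] := ab_mono_normal abC (mono_comp mm mk).
have [s sq] : exists s, s ∘ q = q2.
  by apply: (cokernel_lift cq); rewrite -me -ke' (compA m) compA (proj1 kq2) comp0m.
have [t mkt] : exists t, m ∘ k ∘ t = m.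
  by apply: (kernel_lift kq2); rewrite -sq -compA (proj1 km) compm0.
have kt : k ∘ t = idm I by apply: mm; rewrite compA mkt compm1.
by rewrite -[g]compm1 -kt compA (proj1 kk) comp0m.
Qed.

(** Replaces the choice of preimages in diagram chases: a map into [B] lifts through [e] after
    passing to a cover [p]. The pullback is the kernel of [d] on the biproduct, and [d] is the
    cokernel of that kernel. *)
Lemma pullback_epi (A B T : C) (e : Hom A B) (x : Hom T B) : epi e ->
  exists (P : C) (p : Hom P T) (y : Hom P A), epi p /\ e ∘ y = x ∘ p.
Proof.
move=> ee; have [S [i1 [i2 [p1 [p2 [e11 e22 e12 e21 _]]]]]] := ab_biproduct abC A T.
pose d := e ∘ p1 - x ∘ p2.
have di1 : d ∘ i1 = e by rewrite compBm -!compA e11 e21 compm1 compm0 subr0.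
have ed : epi d by apply: (@epi_compr _ _ _ _ _ i1); rewrite di1.
have [P [k kd]] := ab_kernel abC d.
exists P, (p2 ∘ k), (p1 ∘ k); split; last first.
  by apply/eqP; rewrite -subr_eq0 !compA -compBm (proj1 kd).
apply: epi0P => R g gpk.
have [g' g'd] : exists g', g' ∘ d = g ∘ p2.
  by apply: (cokernel_lift (epi_cokernel_kernel ed kd)); rewrite -compA.
have g'0 : g' = 0.
  by apply: (epi_eq0 ee); rewrite -di1 compA g'd -compA e21 compm0.
by rewrite -[g]compm1 -e22 compA -g'd g'0 !comp0m.
Qed.

Lemma pushout_mono (A B T : C) (m : Hom A B) (x : Hom A T) : mono m ->
  exists (P : C) (p : Hom T P) (y : Hom B P), mono p /\ y ∘ m = p ∘ x.
Proof.
move=> mm; have [S [i1 [i2 [p1 [p2 [e11 e22 e12 e21 _]]]]]] := ab_biproduct abC B T.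
pose d := i1 ∘ m - i2 ∘ x.
have di1 : p1 ∘ d = m by rewrite compmB !compA e11 e12 comp1m comp0m subr0.
have md : mono d by apply: (@mono_compl _ _ _ _ p1); rewrite di1.
have [P [k kd]] := ab_cokernel abC d.
exists P, (k ∘ i2), (k ∘ i1); split; last first.
  by apply/eqP; rewrite -subr_eq0 -!compA -compmB (proj1 kd).
apply: mono0P => R g gpk.
have [g' g'd] : exists g', d ∘ g' = i2 ∘ g.
  by apply: (kernel_lift (mono_kernel_cokernel md kd)); rewrite compA.
have g'0 : g' = 0.
  by apply: (mono_eq0 mm); rewrite -di1 -compA g'd compA e12 comp0m.
by rewrite -[g]comp1m -e22 -compA -g'd g'0 !compm0.
Qed.

(** * Generators and essential extensions *)

Variables (G : C) (genG : is_generator G).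

Lemma generator_eq0 (A B : C) (f : Hom A B) :
  (forall h : Hom G A, f ∘ h = 0) -> f = 0.
Proof. by move=> fh; apply: genG => h; rewrite fh comp0m. Qed.

Lemma generator_neq0 (A B : C) (f : Hom A B) :
  f <> 0 -> exists h : Hom G A, f ∘ h <> 0.
Proof.
move=> f0; apply: NNPP => nh; apply/f0/generator_eq0 => h; apply: NNPP => fh.
by apply: nh; exists h.
Qed.

Lemma generator_epi (A B : C) (f : Hom A B) :
  (forall h : Hom G B, exists h', f ∘ h' = h) -> epi f.
Proof.
move=> fs; apply: epi0P => T g gf; apply: generator_eq0 => h.
by have [h' <-] := fs h; rewrite compA gf comp0m.
Qed.

Definition essential (A B : C) (m : Hom A B) : Prop :=
  mono m /\ forall (T : C) (g : Hom B T), mono (g ∘ m) -> mono g.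

Lemma essential_comp (A B E : C) (n : Hom B E) (m : Hom A B) :
  essential n -> essential m -> essential (n ∘ m).
Proof.
move=> [mn en] [mm em]; split; first exact: mono_comp.
by move=> T g; rewrite compA => /em/en.
Qed.

(** A nonzero submodule meets an essential one. The cokernel of [x] cannot stay mono on [A], so the
    image of [x] contains a nonzero piece of [A]; pulling back along [e] and probing with [G]
    exhibits it as a multiple [x ∘ r]. *)
Lemma essential_point (A B : C) (m : Hom A B) (x : Hom G B) :
  essential m -> x <> 0 ->
  exists (r : Hom G G) (b : Hom G A), x ∘ r = m ∘ b /\ b <> 0.
Proof.
move=> [mm em] x0.
have [Q [q cq]] := ab_cokernel abC x.
have [T [f [qmf f0]]] : exists (T : C) (f : Hom T A), q ∘ m ∘ f = 0 /\ f <> 0.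
  apply: NNPP => nf; apply: x0; apply: (mono_eq0 (em _ q _) (proj1 cq)).
  by apply: mono0P => T f qmf; apply: NNPP => f0; apply: nf; exists T, f.
have [h fh] := generator_neq0 f0.
have [I [i [e [mi ee ie]]]] := image_factor x.
have ci : is_cokernel i q.
  apply: is_cokernelP => [||S s si]; first exact: cokernel_epi cq.
    by apply: (epi_eq0 ee); rewrite -compA ie (proj1 cq).
  by apply: (cokernel_lift cq); rewrite -ie compA si comp0m.
have [y iy] : exists y, i ∘ y = m ∘ (f ∘ h).
  apply: (kernel_lift (mono_kernel_cokernel mi ci)).
  by rewrite !compA qmf comp0m.
have [P [p [z [ep ez]]]] := pullback_epi y ee.
have [|r' r'0] := @generator_neq0 _ _ (f ∘ h ∘ p).
  by move/(epi_eq0 ep).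
exists (z ∘ r'), (f ∘ h ∘ p ∘ r'); split=> //.
by rewrite -ie -compA (compA e) ez !compA iy !compA.
Qed.

End Abelian.

(** * Direct limits in a Grothendieck category *)

Section Limits.
Variables (C : category) (grC : is_grothendieck C).
Let abC : is_abelian C := gr_abelian grC.

(** The usual presentation: the cokernel of a difference of two maps between coproducts, the first
    having one summand for each comparable pair. *)
Lemma direct_limit_exists (I : small) (le : I -> I -> Prop)
  (A : direct_system C le) :
  exists (L : C) (c : forall i, Hom (A i) L), is_direct_limit c.
Proof.
have [S [inj Su]] := gr_coproduct grC A.
pose J := {ij : I * I | le ij.1 ij.2}.
have [S2 [inj2 Su2]] := gr_coproduct grC (fun j : J => A (sval j).1).
have [u [uE _]] := Su2 S (fun j => inj (sval j).1).
have [v [vE _]] := Su2 S (fun j => inj (sval j).2 ∘ ds_map A (proj2_sig j)).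
have [L [q cq]] := ab_cokernel abC (u - v).
exists L, (fun i => q ∘ inj i); split=> [i j p|T f fc].
  pose ij : J := exist _ (i, j) p.
  have : q ∘ (u - v) ∘ inj2 ij = 0 by rewrite (proj1 cq) comp0m.
  rewrite -compA compBm uE vE compmB compA => /eqP.
  by rewrite subr_eq0 => /eqP /esym.
have [h [hE hu]] := Su T f.
have [k kq] : exists k, k ∘ q = h.
  apply: (cokernel_lift cq).
  have [w [_ wu]] := Su2 T (fun j => f (sval j).1).
  rewrite compmB; apply/eqP; rewrite subr_eq0; apply/eqP.
  rewrite -(wu (h ∘ u)) => [|j]; last by rewrite -compA uE hE.
  by apply: wu => j; rewrite -compA vE compA hE fc.
exists k; split=> [i|k' k'E]; first by rewrite compA kq hE.
apply: (cokernel_epi cq); rewrite kq; apply: hu => i.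
by rewrite -compA k'E.
Qed.

Lemma direct_limit_eq (I : small) (le : I -> I -> Prop)
  (A : direct_system C le) (L T : C) (c : forall i, Hom (A i) L)
  (f g : Hom L T) :
  is_direct_limit c -> (forall i, f ∘ c i = g ∘ c i) -> f = g.
Proof.
move=> [cc cu] e; have [|h [_ hu]] := cu T (fun i => g ∘ c i).
  by move=> i j p; rewrite -compA cc.
by rewrite -(hu f) // -(hu g).
Qed.

(** Exactness of limits is formulated for short exact sequences, so the cokernels of the [f i] are
    first assembled into a direct system; then [l] is a kernel. *)
Lemma direct_limit_mono (I : small) (le : I -> I -> Prop)
  (A B : direct_system C le) (f : forall i, Hom (A i) (B i)) (LA LB : C)
  (a : forall i, Hom (A i) LA) (b : forall i, Hom (B i) LB) (l : Hom LA LB) :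
  directed le -> system_map f -> (forall i, mono (f i)) ->
  is_direct_limit a -> is_direct_limit b ->
  (forall i, l ∘ a i = b i ∘ f i) -> mono l.
Proof.
move=> dir sf mf la lb lE.
have ckf i : {Q : C & {q : Hom (B i) Q | is_cokernel (f i) q}}.
  have /constructive_indefinite_description[Q Qq] := ab_cokernel abC (f i).
  by exists Q; apply: constructive_indefinite_description.
pose Q i := projT1 (ckf i); pose q i : Hom (B i) (Q i) := sval (projT2 (ckf i)).
have cq i : is_cokernel (f i) (q i) := svalP (projT2 (ckf i)).
have qm i j (p : le i j) : {h | h ∘ q i = q j ∘ ds_map B p}.
  apply: constructive_indefinite_description; apply: (cokernel_lift (cq i)).
  by rewrite -compA -sf compA (proj1 (cq j)) comp0m.
have eqq i : epi (q i) := cokernel_epi (cq i).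
have Q1 i (p : le i i) : sval (qm i i p) = idm (Q i).
  by apply: (eqq i); rewrite (svalP (qm i i p)) ds_map1 compm1 comp1m.
have QM i j k (p : le i j) (p' : le j k) (r : le i k) :
    sval (qm j k p') ∘ sval (qm i j p) = sval (qm i k r).
  apply: (eqq i); rewrite -compA (svalP (qm i j p)) compA (svalP (qm j k p')).
  by rewrite (svalP (qm i k r)) -compA; congr (_ ∘ _); apply: ds_mapM.
pose E := DirectSystem Q1 QM.
have [LE [e le']] := direct_limit_exists E.
have sq : @system_map C I le B E q by move=> i j p; rewrite /= (svalP (qm i j p)).
have se i : short_exact (f i) (q i).
  by split=> //; apply: mono_kernel_cokernel.
have [lg [lgE _]] : exists! h : Hom LB LE, forall i, h ∘ b i = e i ∘ q i.
  apply: (proj2 lb) => i j p.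
  by rewrite -compA -(svalP (qm i j p)) compA (proj1 le' i j p).
have [km _] := gr_exact_limits grC dir sf sq se la lb le' lE lgE.
exact: kernel_mono km.
Qed.

Section Constant.
Variables (I : small) (le : I -> I -> Prop) (A : C).

Definition const_system : direct_system C le.
Proof.
by exists (fun _ => A) (fun i j p => idm A) => [i p|i j k p q r]; rewrite ?comp1m.
Defined.

Lemma const_direct_limit : directed le ->
  @is_direct_limit C I le const_system A (fun _ => idm A).
Proof.
move=> [[i0] _ _ up]; split=> [i j p|T f fc]; first by rewrite /= comp1m.
exists (f i0); split=> [i|h hE]; last by rewrite -(hE i0) compm1.
have [k [ik jk]] := up i0 i.
rewrite compm1 -(fc _ _ ik) -(fc _ _ jk); congr (_ ∘ _).
Qed.

End Constant.

(** [direct_limit_mono] with a constant source system, whose limit is [A] itself. *)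
Lemma cocone_mono (I : small) (le : I -> I -> Prop) (A : C)
  (B : direct_system C le) (L : C) (c : forall i, Hom (B i) L)
  (m : forall i, Hom A (B i)) (l : Hom A L) :
  directed le -> (forall i, mono (m i)) ->
  (forall i j (p : le i j), ds_map B p ∘ m i = m j) ->
  is_direct_limit c -> (forall i, c i ∘ m i = l) -> mono l.
Proof.
move=> dir mm cm lc lE.
apply: (@direct_limit_mono I le (const_system le A) B m A L _ c l) => //.
- by move=> i j p /=; rewrite compm1 cm.
- exact: const_direct_limit.
- by move=> i; rewrite compm1 lE.
Qed.

Lemma direct_limit_mono_out (I : small) (le : I -> I -> Prop) (T : C)
  (A : direct_system C le) (L : C) (c : forall i, Hom (A i) L) (l : Hom L T) :
  directed le -> is_direct_limit c -> (forall i, mono (l ∘ c i)) -> mono l.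
Proof.
move=> dir lc mm.
apply: (@direct_limit_mono I le A (const_system le T) (fun i => l ∘ c i)
          L T c (fun=> idm T) l) => //.
- by move=> i j p /=; rewrite comp1m -compA (proj1 lc i j p).
- exact: const_direct_limit.
- by move=> i; rewrite comp1m.
Qed.

(* Although T may be large, a chain in T is cofinally indexed by its labels,
   hence has a small direct limit. *)
Lemma zorn_diagram (T : Type) (ob : T -> C)
  (mor : forall s t, Hom (ob s) (ob t) -> Prop) (K : small) (lab : T -> K) :
  T ->
  (forall t, mor t t (idm (ob t))) ->
  (forall r s t f g, mor s t f -> mor r s g -> mor r t (f ∘ g)) ->
  (forall s t f g, mor s t f -> mor s t g -> f = g) ->
  (forall s t f, lab s = lab t -> mor s t f -> exists g, mor t s g) ->
  (forall (I : small) (le : I -> I -> Prop) (r : I -> T)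
     (phi : forall i j, le i j -> Hom (ob (r i)) (ob (r j)))
     (phi1 : forall i (p : le i i), phi i i p = idm _)
     (phiM : forall i j k (p : le i j) (q : le j k) (s : le i k),
        phi j k q ∘ phi i j p = phi i k s),
     directed le -> (forall i j p, mor (r i) (r j) (phi i j p)) ->
     forall (L : C) (c : forall i, Hom (DirectSystem phi1 phiM i) L),
     is_direct_limit c -> exists t, forall i, exists f, mor (r i) t f) ->
  exists t, forall s f, mor t s f -> exists g, mor s t g.
Proof.
move=> t0 mor1 morM thin labP ub.
have [|||t tmax] := @zorn_preorder T (fun s t => exists f, mor s t f).
- by move=> t; exists (idm _).
- by move=> r s t [f mf] [g mg]; exists (g ∘ f); apply: morM mf.
- move=> A cA; have [[t1 At1]|nA] := classic (exists t, A t); last first.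
    by exists t0 => s As; case: nA; exists s.
  (* The labels attained on the chain; [r] picks one member of the chain for each. *)
  pose I : small := {k : K | exists2 t, A t & lab t = k}.
  have [r rP] := @choice_fun I T (fun i t => A t /\ lab t = sval i)
                   (fun i => let: exist _ (ex_intro2 t At e) := i in
                             ex_intro _ t (conj At e)).
  pose le (i j : I) := exists f, mor (r i) (r j) f.
  have dir : directed le.
    split=> [|i|i j k [f mf] [g mg]|i j].
    - by split; exists (lab t1); exists t1.
    - by exists (idm _).
    - by exists (g ∘ f); apply: morM mf.
    - case: (cA _ _ (proj1 (rP i)) (proj1 (rP j))) => ij; last first.
        by exists i; split=> //; exists (idm _).
      by exists j; split=> //; exists (idm _).
  pose phi i j (p : le i j) := sval (constructive_indefinite_description _ p).
  have phiP i j p : mor (r i) (r j) (phi i j p).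
    by rewrite /phi; case: constructive_indefinite_description.
  have phi1 i (p : le i i) : phi i i p = idm _ by apply: thin (phiP _ _ _) (mor1 _).
  have phiM i j k (p : le i j) (q : le j k) (s : le i k) :
      phi j k q ∘ phi i j p = phi i k s.
    by apply: thin (phiP _ _ s); apply: morM (phiP _ _ _) (phiP _ _ _).
  have [L [c lc]] := direct_limit_exists (DirectSystem phi1 phiM).
  have [t tP] := ub I le r phi phi1 phiM dir phiP L c lc.
  exists t => s As.
  pose i : I := exist _ (lab s) (ex_intro2 _ _ s As erefl).
  have [f mf] := tP i; have [Ai labi] := rP i.
  (* [s] and its representative share a label, so a morphism in either direction yields one out of
     [s]. *)
  have [g mg] : exists g, mor s (r i) g.
    case: (cA _ _ As Ai) => // -[g mg]; exact: labP mg.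
  by exists (f ∘ g); apply: morM mg.
by exists t => s f mf; apply: tmax; exists f.
Qed.

End Limits.

(** * Enough injectives *)

Section EnoughInjectives.
Variables (C : category) (grC : is_grothendieck C).
Let abC : is_abelian C := gr_abelian grC.
Variables (G : C) (genG : is_generator G).

Section EssentialQuotient.
Variables (N P : C) (n : Hom N P).

Record quotient_off := QuotientOff {
  qo_ob : C;
  qo_map : Hom P qo_ob;
  qo_epi : epi qo_map;
  qo_mono : mono (qo_map ∘ n) }.

(** Zorn on the quotients of [P] on which [N] stays mono, each labelled by the maps from [G] that it
    kills. Direct limits of such quotients are bounds, by [cocone_mono]. *)
Lemma essential_quotient : mono n ->
  exists (Q : C) (q : Hom P Q), epi q /\ essential (q ∘ n).
Proof.
move=> mn.
have id_epi : epi (idm P) by move=> T f g; rewrite !compm1.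
have id_mono : mono (idm P ∘ n) by rewrite comp1m.
have [||||||t tmax] := @zorn_diagram C grC quotient_off qo_ob
  (fun s t f => f ∘ qo_map s = qo_map t) (Hom G P -> Prop)
  (fun t h => qo_map t ∘ h = 0).
- exact: QuotientOff id_epi id_mono.
- by move=> t; rewrite comp1m.
- by move=> r s t f g fE gE; rewrite -compA gE.
- by move=> s t f g fE gE; apply: (@qo_epi s); rewrite fE gE.
- move=> s t f labst fE.
  (* Equal labels mean equal kernels, since maps from [G] detect zero. *)
  have [K [k kk]] := ab_kernel abC (qo_map t).
  apply: (cokernel_lift (epi_cokernel_kernel abC (@qo_epi t) kk)).
  apply: (generator_eq0 genG) => h; rewrite -compA.
  have -> : (qo_map s ∘ (k ∘ h) = 0) = (qo_map t ∘ (k ∘ h) = 0).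
    exact: (congr1 (fun p => p (k ∘ h)) labst).
  by rewrite compA (proj1 kk) comp0m.
- move=> I le r phi phi1 phiM dir phiP L c lc.
  have [[i0] _ _ up] := dir.
  pose q : Hom P L := c i0 ∘ qo_map (r i0).
  have cq i : c i ∘ qo_map (r i) = q.
    have [k [ik jk]] := up i i0.
    rewrite /q -(proj1 lc _ _ ik) -(proj1 lc _ _ jk) -!compA.
    by congr (_ ∘ _); rewrite /= !phiP.
  have eq : epi q.
    apply: epi0P => T g gq; apply: (direct_limit_eq lc) => i.
    rewrite comp0m; apply: (epi_eq0 (@qo_epi (r i))).
    by rewrite -compA cq.
  have mq : mono (q ∘ n).
    apply: (@cocone_mono C grC I le N (DirectSystem phi1 phiM) L c
              (fun i => qo_map (r i) ∘ n)) => // [i|i j p|i].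
    - exact: (@qo_mono (r i)).
    - by rewrite /= compA phiP.
    - by rewrite compA cq.
  by exists (QuotientOff eq mq) => i; exists (c i); apply: cq.
exists (qo_ob t), (qo_map t); split; first exact: qo_epi.
split=> [|T g mg]; first exact: qo_mono.
(* The quotient [e ∘ qo_map t] still keeps [N] mono, so maximality splits [e], and [g = m ∘ e] is
   mono. *)
have [J [m [e [mm ee me]]]] := image_factor abC g.
have eeq : epi (e ∘ qo_map t) by apply: epi_comp (@qo_epi t).
have meq : mono (e ∘ qo_map t ∘ n).
  by apply: (@mono_compl _ _ _ _ m); rewrite -!compA compA me.
have [s sE] := tmax (QuotientOff eeq meq) e erefl.
have se : s ∘ e = idm _ by apply: (@qo_epi t); rewrite -compA [LHS]sE comp1m.
rewrite -me; apply: mono_comp => //; apply: (@mono_compl _ _ _ _ s).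
by rewrite se => U x y; rewrite !comp1m.
Qed.

End EssentialQuotient.

Section EssentialExtension.
Variables (M : C) (chi : Hom G M -> Hom G M -> algC).
Hypothesis chi_char : forall a, is_char (chi a).
Hypothesis chi_sep : forall a, a <> 0 -> chi a a <> 1.

(** The extended characters belong to the data: morphisms have to respect them, which makes
    morphisms unique, as [zorn_diagram] demands. *)
Record essential_ext := EssentialExt {
  ee_ob : C;
  ee_map : Hom M ee_ob;
  ee_chi : Hom G M -> Hom G ee_ob -> algC;
  ee_essential : essential ee_map;
  ee_char : forall a, is_char (ee_chi a);
  ee_chiE : forall a b, ee_chi a (ee_map ∘ b) = chi a b }.

Arguments ee_chi : clear implicits.

Definition ee_mor (s t : essential_ext) (f : Hom (ee_ob s) (ee_ob t)) : Prop :=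
  f ∘ ee_map s = ee_map t /\ forall a x, ee_chi t a (f ∘ x) = ee_chi s a x.

Let eval (t : essential_ext) (x : Hom G (ee_ob t)) :
  Hom G M -> Hom G G -> algC := fun a r => ee_chi t a (x ∘ r).

(** If [x - y] is nonzero, some multiple of it is a nonzero [b] from [M], and the character with
    index [b] is not 1 there. *)
Lemma ee_eval_inj (t : essential_ext) (x y : Hom G (ee_ob t)) :
  eval x = eval y -> x = y.
Proof.
move=> e; apply/eqP; rewrite -subr_eq0; apply/eqP; apply: NNPP => xy.
have [r [b [rb b0]]] := essential_point abC genG (ee_essential t) xy.
apply: (chi_sep b0); rewrite -(ee_chiE t) -rb compBm (proj2 (ee_char t b)).
rewrite -[ee_chi t b (x ∘ r)]/(eval x b r) e /eval.
by rewrite -(proj2 (ee_char t b)) subrr (proj1 (ee_char t b)).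
Qed.

Lemma ee_mor_mono (s t : essential_ext) (f : Hom (ee_ob s) (ee_ob t)) :
  ee_mor f -> mono f.
Proof.
by move=> [fE _]; apply: (proj2 (ee_essential s)); rewrite fE; case: (ee_essential t).
Qed.

(** The characters glue on those maps [G -> L] that factor through some [A i]. These may form a
    proper subgroup, because [G] need not be finitely generated; hence the appeal to
    [char_extension]. *)
Lemma ee_upper_bound (I : small) (le : I -> I -> Prop) (A : direct_system C le)
  (m : forall i, Hom M (A i)) (psi : forall i, Hom G M -> Hom G (A i) -> algC)
  (L : C) (c : forall i, Hom (A i) L) :
  directed le -> is_direct_limit c ->
  (forall i, essential (m i)) -> (forall i a, is_char (psi i a)) ->
  (forall i a b, psi i a (m i ∘ b) = chi a b) ->
  (forall i j (p : le i j), ds_map A p ∘ m i = m j) ->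
  (forall i j (p : le i j) a x, psi j a (ds_map A p ∘ x) = psi i a x) ->
  exists (l : Hom M L) (psiL : Hom G M -> Hom G L -> algC),
  [/\ essential l, forall a, is_char (psiL a),
      forall a b, psiL a (l ∘ b) = chi a b, forall i, c i ∘ m i = l
    & forall i a x, psiL a (c i ∘ x) = psi i a x].
Proof.
move=> dir lc em cp pm dm dp; have [[i0] lerefl _ up] := dir.
pose l : Hom M L := c i0 ∘ m i0.
have cm i : c i ∘ m i = l.
  have [k [ik jk]] := up i i0.
  by rewrite /l -(proj1 lc _ _ ik) -(proj1 lc _ _ jk) -!compA !dm.
have el : essential l.
  split; first by apply: (cocone_mono grC dir (fun i => proj1 (em i)) dm lc).
  move=> T g mg; apply: (direct_limit_mono_out grC dir lc) => i.
  by apply: (proj2 (em i)); rewrite -compA cm.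
have mc i : mono (c i) by apply: (proj2 (em i)); rewrite cm; case: el.
pose graph a (y : Hom G L) (u : algC) :=
  exists i x, y = c i ∘ x /\ u = psi i a x.
have graphP a : partial_char (graph a).
  split.
  - by exists i0, 0; rewrite compm0 (proj1 (cp i0 a)).
  - move=> _ _ _ _ [i [x [-> ->]]] [j [y [-> ->]]].
    have [k [ik jk]] := up i j.
    exists k, (ds_map A ik ∘ x - ds_map A jk ∘ y); split.
      by rewrite compmB !compA (proj1 lc _ _ ik) (proj1 lc _ _ jk).
    by rewrite (proj2 (cp k a)) !dp.
  - move=> _ [i [x [cx ->]]]; have x0 : x = 0 by apply: (mono_eq0 (mc i)).
    by rewrite x0 (proj1 (cp i a)).
have [psiL psiLP] := choice_fun (fun a =>
  let: ex_intro2 f fc fE := char_extension (graphP a) in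
  ex_intro (fun f => is_char f /\ forall y u, graph a y u -> f y = u) f (conj fc fE)).
have psiLE i a x : psiL a (c i ∘ x) = psi i a x.
  by apply: (proj2 (psiLP a)); exists i, x.
exists l, psiL; split=> // [a|a b]; first by case: (psiLP a).
by rewrite -(cm i0) -compA psiLE pm.
Qed.

(** The label is the range of [eval]. A morphism between extensions with the same range is
    surjective on maps from [G], hence epi; it is mono by essentiality, so it is invertible. *)
Lemma maximal_essential_ext : exists t : essential_ext,
  forall s (f : Hom (ee_ob t) (ee_ob s)), ee_mor f ->
  exists g : Hom (ee_ob s) (ee_ob t), ee_mor g.
Proof.
apply: (@zorn_diagram C grC essential_ext ee_ob ee_mor
  ((Hom G M -> Hom G G -> algC) -> Prop) (fun t phi => exists x, phi = @eval t x)).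
- apply: (@EssentialExt M (idm M) chi) => // [|a b]; last by rewrite comp1m.
  by split=> [T f g|T g]; rewrite ?comp1m ?compm1.
- by move=> t; split=> [|a x]; rewrite comp1m.
- move=> r s t f g [fE fP] [gE gP]; split=> [|a x]; first by rewrite -compA gE.
  by rewrite -compA fP gP.
- move=> s t f g [_ fP] [_ gP]; apply: genG => h; apply: ee_eval_inj.
  apply: functional_extensionality => a; apply: functional_extensionality => r.
  by rewrite /eval -!compA fP gP.
- move=> s t f labst fP; have [fE fchi] := fP.
  have ef : epi f.
    apply: (generator_epi genG) => y.
    have [x yx] : exists x, eval y = @eval s x.
      rewrite -[exists x, _]/((fun phi => exists x, phi = @eval s x) (eval y)).
      by rewrite labst; exists y.
    exists x; apply: ee_eval_inj; rewrite yx.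
    apply: functional_extensionality => a; apply: functional_extensionality => r.
    by rewrite /eval -compA fchi.
  have [g [gf fg]] := mono_epi_iso abC (ee_mor_mono fP) ef.
  exists g; split=> [|a x]; first by rewrite -fE compA gf comp1m.
  by rewrite -fchi compA fg comp1m.
- move=> I le r phi phi1 phiM dir phiP L c lc.
  have [||||l [psiL [el cl lE cm cE]]] := @ee_upper_bound I le
    (DirectSystem phi1 phiM) (fun i => ee_map (r i)) (fun i => ee_chi (r i))
    L c dir lc (fun i => ee_essential (r i)).
  - by move=> i; apply: ee_char.
  - by move=> i; apply: ee_chiE.
  - by move=> i j p; case: (phiP i j p).
  - by move=> i j p; case: (phiP i j p).
  by exists (EssentialExt el cl lE) => i; exists (c i); split; [apply: cm | apply: cE].
Qed.

End EssentialExtension.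

Arguments ee_chi {M chi} _ _ _.

Lemma enough_injectives (M : C) :
  exists (E : C) (m : Hom M E), mono m /\ injective E.
Proof.
have sep (a : Hom G M) : exists f, is_char f /\ (a <> 0 -> f a <> 1).
  have [->|a0] := classic (a = 0).
    by exists (fun _ => 1); split=> //; split=> // x y; rewrite divr1.
  by have [f fc fa] := char_separates a0; exists f.
have [chi chiP] := choice_fun sep.
have [t tmax] := maximal_essential_ext (fun a => proj1 (chiP a))
                                       (fun a => proj2 (chiP a)).
exists (ee_ob t), (ee_map t); split; first by case: (ee_essential t).
(* The characters extend along [n], so maximality gives a map back; it preserves characters, and
   [ee_eval_inj] makes it a retraction. *)
have split_ess N (n : Hom (ee_ob t) N) : essential n -> exists s, s ∘ n = idm _.
  move=> en.
  have gP a : partial_char (fun (y : Hom G N) u =>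
      exists x, y = n ∘ x /\ u = ee_chi t a x).
    have [c0 cB] := ee_char t a; split.
    - by exists 0; rewrite compm0 c0.
    - move=> _ _ _ _ [x [-> ->]] [y [-> ->]].
      by exists (x - y); rewrite compmB cB.
    - by move=> _ [x [nx ->]]; rewrite (mono_eq0 (proj1 en) (esym nx)).
  have [psi psiP] := choice_fun (fun a =>
    let: ex_intro2 f fc fE := char_extension (gP a) in
    ex_intro (fun f => is_char f /\ forall y u, (exists x, y = n ∘ x /\
                u = ee_chi t a x) -> f y = u) f (conj fc fE)).
  have psiE a x : psi a (n ∘ x) = ee_chi t a x.
    by apply: (proj2 (psiP a)); exists x.
  have psiM a b : psi a (n ∘ ee_map t ∘ b) = chi a b.
    by rewrite -compA psiE ee_chiE.
  pose s := EssentialExt (essential_comp en (ee_essential t))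
                         (fun a => proj1 (psiP a)) psiM.
  have [g [gE gP']] := tmax s n (conj erefl psiE).
  exists g; apply: genG => h; rewrite comp1m.
  apply: (ee_eval_inj (fun a => proj2 (chiP a))).
  apply: functional_extensionality => a; apply: functional_extensionality => r.
  by rewrite -!compA gP' /= psiE.
move=> A B m mm f.
(* A pushout turns the extension problem into splitting the mono [p]; a quotient of [P] makes it
   essential, hence split. *)
have [P [p [y [mp ym]]]] := pushout_mono abC f mm.
have [Q [q [_ eqp]]] := essential_quotient mp.
have [s sE] := split_ess _ _ eqp.
by exists (s ∘ q ∘ y); rewrite -compA ym !compA -(compA s) sE comp1m.
Qed.

(** [is_right_derived] constrains the values of a functor only through resolutions, so they must
    exist for it to say anything. *)
Lemma injective_resolution_exists (M : C) : inhabited (injective_resolution M).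
Proof.
have embed (Z : C) : {E : C & {m : Hom Z E | mono m /\ injective E}}.
  have /constructive_indefinite_description[E Em] := enough_injectives Z.
  by exists E; apply: constructive_indefinite_description.
pose J Z := projT1 (embed Z); pose j Z : Hom Z (J Z) := sval (projT2 (embed Z)).
have jP Z : mono (j Z) /\ injective (J Z) := svalP (projT2 (embed Z)).
have cok (Z : C) : {Q : C & {q : Hom (J Z) Q | is_cokernel (j Z) q}}.
  have /constructive_indefinite_description[Q Qq] := ab_cokernel abC (j Z).
  by exists Q; apply: constructive_indefinite_description.
pose S Z := projT1 (cok Z); pose q Z : Hom (J Z) (S Z) := sval (projT2 (cok Z)).
have qP Z : is_cokernel (j Z) (q Z) := svalP (projT2 (cok Z)).
(* The n-th cosyzygy: each step takes the cokernel of the embedding into an injective. *)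
pose Z n := iter n S M.
pose d n : Hom (J (Z n)) (J (Z n.+1)) := j (Z n.+1) ∘ q (Z n).
have dk n : is_kernel (d n) (j (Z n)).
  have kq := mono_kernel_cokernel abC (proj1 (jP (Z n))) (qP (Z n)).
  apply: is_kernelP => [||T h]; first by case: (jP (Z n)).
    by rewrite -compA (proj1 (qP (Z n))) compm0.
  rewrite -compA => /(mono_eq0 (proj1 (jP _))); exact: kernel_lift kq.
split; apply: (@InjectiveResolution C M (fun n => J (Z n)) d (j M)).
- by move=> n; case: (jP (Z n)).
- exact: (dk 0).
- move=> n; split; first by rewrite /d compA (proj1 (dk n.+1)) comp0m.
  move=> K k kk h kh.
  have [t jt] := kernel_lift kk (proj1 (dk n.+1)).
  have htq : h = t ∘ q (Z n).
    by apply: (kernel_mono kk); rewrite kh compA jt.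
  have [u ju] := kernel_lift (dk n.+1) (proj1 kk).
  have tu : t ∘ u = idm K.
    by apply: (kernel_mono kk); rewrite compA jt ju compm1.
  rewrite htq; apply: epi_comp (cokernel_epi (qP (Z n))).
  by apply: (@epi_compr _ _ _ _ _ u); rewrite tu => T f g; rewrite !compm1.
Qed.

End EnoughInjectives.

(** * Equivalences and divisors *)

Lemma nat_isomorphic_sym (C D : category) (F G : functor C D) :
  nat_isomorphic F G -> nat_isomorphic G F.
Proof.
move=> [t ti].
pose s A := sval (constructive_indefinite_description _ (ti A)).
have sP A : s A ∘ t A = idm _ /\ t A ∘ s A = idm _.
  by rewrite /s; case: constructive_indefinite_description.
have sN (A B : C) (f : Hom A B) : s B ∘ fmap G f = fmap F f ∘ s A.
  rewrite -[LHS]compm1 -(proj2 (sP A)) -[_ ∘ (t A ∘ _)]compA (compA _ (t A)).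
  by rewrite -(ncompE t) !compA (proj1 (sP B)) comp1m.
by exists (NatTrans sN) => A; exists (t A); have [] := sP A.
Qed.

Section Equivalence.
Variables (C D : category) (R : functor D C).
Hypothesis eqR : is_equivalence R.

Lemma nat_iso_id_faithful (E : category) (H : functor E E) :
  nat_isomorphic H (idF E) ->
  forall (A B : E) (f g : Hom A B), fmap H f = fmap H g -> f = g.
Proof.
move=> [t ti] A B f g e; apply: (iso_epi (ti A)).
have N (h : Hom A B) : h ∘ t A = t B ∘ fmap H h by rewrite (ncompE t).
by rewrite !N e.
Qed.

Lemma equivalence_faithful (A B : D) (f g : Hom A B) :
  fmap R f = fmap R g -> f = g.
Proof.
case: eqR => Q [GR _] e.
by apply: (nat_iso_id_faithful GR); rewrite /= e.
Qed.

Lemma equivalence_full (A B : D) (h : Hom (R A) (R B)) :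
  exists f, fmap R f = h.
Proof.
case: eqR => Q [GR RG]; have [t ti] := GR; have [s [st ts]] := ti A.
(* The preimage dictated by naturality of [t]. Its image is compared with [h] after applying [Q],
   which suffices because [R ∘ Q] is faithful. *)
exists (t B ∘ fmap Q h ∘ s); apply: (nat_iso_id_faithful RG) => /=.
congr (fmap R _); apply: (iso_mono (ti B)).
apply: etrans (ncompE t _) _ => /=.
by rewrite -!compA st compm1.
Qed.

Lemma equivalence_surj (A : C) : exists (B : D) (s : Hom (R B) A), is_iso s.
Proof. by case: eqR => Q [_ [t ti]]; exists (Q A), (t A); apply: ti. Qed.

Lemma equivalence_epi (A B : D) (e : Hom A B) : epi e -> epi (fmap R e).
Proof.
move=> ee T f g; have [T' [s [s' [ss' s's]]]] := equivalence_surj T.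
have [f' fE] := equivalence_full (s' ∘ f).
have [g' gE] := equivalence_full (s' ∘ g).
move=> fg; have : f' ∘ e = g' ∘ e.
  by apply: equivalence_faithful; rewrite !fmapM fE gE -!compA fg.
by move/ee => fg'; rewrite -[f]comp1m -[g]comp1m -s's -!compA -fE -gE fg'.
Qed.

Lemma equivalence_mono (A B : D) (m : Hom A B) : mono m -> mono (fmap R m).
Proof.
move=> mm T f g; have [T' [s [s' [ss' s's]]]] := equivalence_surj T.
have [f' fE] := equivalence_full (f ∘ s).
have [g' gE] := equivalence_full (g ∘ s).
move=> fg; have : m ∘ f' = m ∘ g'.
  by apply: equivalence_faithful; rewrite !fmapM fE gE !compA fg.
by move/mm => fg'; rewrite -[f]compm1 -[g]compm1 -s's !compA -fE -gE fg'.
Qed.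

Lemma equivalence_epi_inv (A B : D) (e : Hom A B) : epi (fmap R e) -> epi e.
Proof.
move=> ee T f g fg; apply: equivalence_faithful; apply: ee.
by rewrite -!fmapM fg.
Qed.

Variables (L : functor C D) (a : adjunction L R).

(** Fullness lifts the unit at [R B] to an inverse of the counit at [B]; essential surjectivity then
    carries invertibility of the unit from the objects [R B] to all objects. *)
Lemma equivalence_adj_iso :
  (forall A, is_iso (adj_unit a A)) /\ (forall B, is_iso (adj_counit a B)).
Proof.
have inv (B : D) : exists s : Hom B (L (R B)), [/\ fmap R s = adj_unit a (R B),
    adj_counit a B ∘ s = idm B & s ∘ adj_counit a B = idm _].
  have [s sE] := equivalence_full (adj_unit a (R B)).
  have es : adj_counit a B ∘ s = idm B.
    by apply: equivalence_faithful; rewrite fmapM sE adj_triR fmap1.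
  exists s; split=> //.
  rewrite [LHS](adj_transposeL a) [RHS](adj_transposeL a); congr (_ ∘ fmap L _).
  by rewrite fmapM -compA adj_triR compm1 sE fmap1 comp1m.
split=> [A|B]; last by have [s [_ es se]] := inv B; exists s.
have [B [t ti]] := equivalence_surj A.
have [s [sE es se]] := inv B; have [t' [tt' t't]] := ti.
have nat : adj_unit a A ∘ t = fmap R (fmap L t) ∘ adj_unit a (R B).
  exact: (ncompE (adj_unit a) t).
have e : adj_unit a A = fmap R (fmap L t ∘ s) ∘ t'.
  by rewrite fmapM sE -nat -compA t't compm1.
have Lt : fmap L t ∘ fmap L t' = idm _ by rewrite -fmapM t't fmap1.
have Lt' : fmap L t' ∘ fmap L t = idm _ by rewrite -fmapM tt' fmap1.
have X1 : adj_counit a B ∘ fmap L t' ∘ (fmap L t ∘ s) = idm _.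
  by rewrite compA -(compA _ _ (fmap L t)) Lt' compm1 es.
have X2 : fmap L t ∘ s ∘ (adj_counit a B ∘ fmap L t') = idm _.
  by rewrite compA -(compA _ s) se compm1 Lt.
exists (t ∘ fmap R (adj_counit a B ∘ fmap L t')); rewrite e; split.
  by rewrite compA -(compA t) -(fmapM R) X1 fmap1 compm1.
by rewrite compA -(compA _ t') tt' compm1 -(fmapM R) X2 fmap1.
Qed.

End Equivalence.

Section Adjunction.
Variables (C D : category) (L : functor C D) (R : functor D C).
Variable a : adjunction L R.

Lemma adj_equivalence : (forall A, is_iso (adj_unit a A)) ->
  (forall B, is_iso (adj_counit a B)) -> is_equivalence R.
Proof.
move=> ui ci; exists L; split; first by exists (adj_counit a).
by apply: nat_isomorphic_sym; exists (adj_unit a).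
Qed.

Lemma left_adjoint_epi (A B : C) (e : Hom A B) : epi e -> epi (fmap L e).
Proof.
move=> ee T f g fg.
rewrite [f](adj_transposeL a) [g](adj_transposeL a); congr (_ ∘ fmap L _).
apply: ee; have nat : adj_unit a B ∘ e = fmap R (fmap L e) ∘ adj_unit a A.
  exact: (ncompE (adj_unit a) e).
by rewrite -!compA nat !compA -!fmapM fg.
Qed.

Hypothesis R0 : forall A B : D, fmap R (0 : Hom A B) = 0.

Lemma left_adjoint0 (A B : C) : fmap L (0 : Hom A B) = 0.
Proof.
rewrite [LHS](adj_transposeL a) [RHS](adj_transposeL a); congr (_ ∘ fmap L _).
rewrite R0 comp0m.
have nat : adj_unit a B ∘ 0 = fmap R (fmap L 0) ∘ adj_unit a A.
  exact: (ncompE (adj_unit a) 0).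
by rewrite -nat compm0.
Qed.

Lemma right_adjoint_kernel (K A B : D) (f : Hom A B) (k : Hom K A) :
  is_kernel f k -> is_kernel (fmap R f) (fmap R k).
Proof.
move=> kk; have nat (U V : D) (h : Hom U V) :
    adj_counit a V ∘ fmap L (fmap R h) = h ∘ adj_counit a U.
  exact: (ncompE (adj_counit a) h).
apply: is_kernelP => [T x y xy||T h fh].
- rewrite [x](adj_transposeR a) [y](adj_transposeR a).
  congr (fmap R _ ∘ _); apply: (kernel_mono kk).
  by rewrite !compA -!nat -!compA -!fmapM xy.
- by rewrite -fmapM (proj1 kk) R0.
have [u uE] : exists u, k ∘ u = adj_counit a A ∘ fmap L h.
  apply: (kernel_lift kk); rewrite compA -nat -compA -fmapM fh.
  by rewrite left_adjoint0 compm0.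
exists (fmap R u ∘ adj_unit a T).
by rewrite compA -fmapM uE -(adj_transposeR a).
Qed.

End Adjunction.

Lemma left_exact0 (C D : category) (F : functor C D) (A B : C) :
  left_exact F -> fmap F (0 : Hom A B) = 0.
Proof.
by case=> FD _; apply: (@addrI _ (fmap F 0)); rewrite -FD !addr0.
Qed.

(** * The natural map from M to M(Y) *)

Section Divisor.
Variables (C : category) (D : divisor C).

Definition div_eta (M : C) : Hom M (twist D M) := div_map D M.

Lemma div_eta_nat (M N : C) (f : Hom M N) :
  div_eta N ∘ f = fmap (twist D) f ∘ div_eta M.
Proof. exact: (ncompE (div_map D) f). Qed.

Let eqD : is_equivalence (twist D) := div_invertible D.

Lemma twist0 (M N : C) : fmap (twist D) (0 : Hom M N) = 0.
Proof. exact: (left_exact0 _ _ (hom_left_exact (div_bimod D))). Qed.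

Lemma div_eta_transpose (M : C) :
  div_eta M = fmap (twist D) (untwist_map D M)
              ∘ adj_unit (tensor_hom_adj (div_bimod D)) M.
Proof. exact: adj_transposeR. Qed.

(** The two maps are adjoint transposes, so Mod Y is also cut out by [div_eta]. *)
Lemma untwist_map_eq0 (M : C) : untwist_map D M = 0 <-> div_eta M = 0.
Proof.
split=> e; first by rewrite div_eta_transpose e twist0 comp0m.
rewrite /untwist_map -/(div_eta M) e.
by rewrite (left_adjoint0 (tensor_hom_adj (div_bimod D)) twist0) compm0.
Qed.

Lemma untwist_map_nat (M N : C) (f : Hom M N) :
  untwist_map D N ∘ fmap (untwist D) f = f ∘ untwist_map D M.
Proof.
rewrite /untwist_map -compA -fmapM -/(div_eta N) div_eta_nat fmapM !compA.
congr (_ ∘ _); exact: (ncompE (adj_counit (tensor_hom_adj (div_bimod D)))).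
Qed.

Lemma untwist_map_epi (M : C) : epi (untwist_map D M) <-> epi (div_eta M).
Proof.
have [ui _] := equivalence_adj_iso eqD (tensor_hom_adj (div_bimod D)).
rewrite div_eta_transpose; split=> [eu|/epi_compr]; last first.
  exact: (equivalence_epi_inv eqD).
by apply: epi_comp; [apply: (equivalence_epi eqD eu) | apply: iso_epi (ui M)].
Qed.

(** By naturality the twist of [q] vanishes on the image of [div_eta M], and twisting is
    faithful. *)
Lemma div_eta_epi_quotient (M Q : C) (q : Hom M Q) :
  epi (div_eta M) -> div_eta Q = 0 -> q = 0.
Proof.
move=> eM Q0; apply: (equivalence_faithful eqD); rewrite twist0.
by apply: (epi_eq0 eM); rewrite -div_eta_nat Q0 comp0m.
Qed.

(** The cokernel of [M(-Y) -> M] is a quotient of [M] on which [div_eta] vanishes. Asking for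
    cokernels alone lets the lemma apply to Mod W as well. *)
Lemma div_eta_epi (M : C) :
  (forall (A B : C) (f : Hom A B), exists (Q : C) (q : Hom B Q), is_cokernel f q) ->
  (forall (Q : C) (q : Hom M Q), epi q -> div_eta Q = 0 -> q = 0) ->
  epi (div_eta M).
Proof.
move=> coker M0; apply/untwist_map_epi.
have [Q [q cq]] := coker _ _ (untwist_map D M).
have eq := cokernel_epi cq.
have q0 : q = 0.
  apply: M0 => //; apply/untwist_map_eq0.
  apply: (epi_eq0 (left_adjoint_epi (tensor_hom_adj (div_bimod D)) eq)).
  exact: etrans (untwist_map_nat q) (proj1 cq).
apply: epi0P => T f fu; have [h <-] := cokernel_lift cq fu.
by rewrite q0 compm0.
Qed.

Lemma div_eta_mono (M : C) :
  (forall (A B : C) (f : Hom A B), exists (K : C) (k : Hom K A), is_kernel f k) ->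
  (forall K : C, div_eta K = 0 -> is_zero K) -> mono (div_eta M).
Proof.
move=> ker M0; have [K [k kk]] := ker _ _ (div_eta M).
have K0 : div_eta K = 0.
  apply: (mono_eq0 (equivalence_mono eqD (kernel_mono kk))).
  by rewrite -div_eta_nat (proj1 kk).
apply: mono0P => T f ef; have [h <-] := kernel_lift kk ef.
by rewrite (proj2 (M0 K K0 M) k) comp0m.
Qed.

Hypothesis abC : is_abelian C.
Variable Y : weakly_closed_subspace C.
Hypothesis YE : forall M, Y M <-> div_eta M = 0.

(** A map killed by [div_eta M] has its image in Mod Y, since twisting preserves monos; hence it
    factors through the counit. *)
Lemma shriek_counit_kernel (M : C) :
  is_kernel (div_eta M) (adj_counit (shriek_adj Y) M : Hom (sval (shriek Y M)) M).
Proof.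
apply: is_kernelP => [||T h eh]; first exact: (counit_mono abC).
  rewrite div_eta_nat (_ : div_eta _ = 0) ?compm0 //.
  by apply/YE; exact: (proj2_sig (shriek Y M)).
have [I [m [e [mm ee me]]]] := image_factor abC h.
have em : div_eta M ∘ m = 0 by apply: (epi_eq0 ee); rewrite -compA me.
have YI : Y I.
  by apply/YE; apply: (mono_eq0 (equivalence_mono eqD mm)); rewrite -div_eta_nat.
have [u uE] := @shriek_factor C Y (exist _ I YI) M m.
by exists (u ∘ e); rewrite compA uE.
Qed.

End Divisor.

(** * Kernels, cokernels and injectives of Mod W *)

Section FullSub.
Variables (C : category) (abC : is_abelian C) (W : weakly_closed_subspace C).

Lemma sub_mono (A B : ModW W) (m : Hom A B) :
  mono (m : @Hom C (sval A) (sval B)) -> mono m.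
Proof. by move=> mm T f g; apply: mm. Qed.

Lemma sub_epi (A B : ModW W) (e : Hom A B) :
  epi (e : @Hom C (sval A) (sval B)) -> epi e.
Proof. by move=> ee T f g; apply: ee. Qed.

Lemma sub_kernel (A B : ModW W) (f : Hom A B) :
  exists (K : ModW W) (k : Hom K A), is_kernel f k.
Proof.
have [K [k kk]] := ab_kernel abC (f : @Hom C (sval A) (sval B)).
have WK : W K := wc_sub (kernel_mono kk) (proj2_sig A).
exists (exist _ K WK), k; split; first by case: kk.
by move=> T h; apply: (proj2 kk).
Qed.

Lemma sub_cokernel (A B : ModW W) (f : Hom A B) :
  exists (Q : ModW W) (q : Hom B Q), is_cokernel f q.
Proof.
have [Q [q cq]] := ab_cokernel abC (f : @Hom C (sval A) (sval B)).
have WQ : W Q := wc_quo (cokernel_epi cq) (proj2_sig B).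
exists (exist _ Q WQ), q; split; first by case: cq.
by move=> T h; apply: (proj2 cq).
Qed.

Lemma sub_mono_epi_iso (A B : ModW W) (f : Hom A B) :
  mono f -> epi f -> is_iso f.
Proof.
move=> mf ef; have [g gP] := mono_epi_iso abC (mono_direct_image abC mf)
                                              (epi_direct_image abC ef).
by exists g.
Qed.

Lemma shriek_injective (E : C) : injective E -> injective (shriek W E).
Proof.
move=> iE A B m mm f.
have [g gE] := iE _ _ _ (mono_direct_image abC mm)
  ((adj_counit (shriek_adj W) E : @Hom C (sval (shriek W E)) E)
   ∘ (f : @Hom C (sval A) _)).
have [h hE] := @shriek_factor C W B E g.
exists h; apply: (@shriek_inj C W A E); rewrite -gE -hE -compA; congr (_ ∘ _).
Qed.

End FullSub.

(** * The first derived functor of the bimodule of a divisor *)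

Lemma exact_lift (C : category) (abC : is_abelian C) (A B E T : C)
  (f : Hom A B) (g : Hom B E) (x : Hom T B) :
  exact f g -> g ∘ x = 0 ->
  exists (P : C) (p : Hom P T) (y : Hom P A), epi p /\ f ∘ y = x ∘ p.
Proof.
move=> [gf fe] gx; have [K [k kk]] := ab_kernel abC g.
have [h hE] := kernel_lift kk gf; have [x' x'E] := kernel_lift kk gx.
have [P [p [y [ep yE]]]] := pullback_epi abC x' (fe K k kk h hE).
by exists P, p, y; split=> //; rewrite -hE -x'E -!compA yE.
Qed.

Lemma cokernel_exact (C : category) (abC : is_abelian C) (A B Q T : C)
  (f : Hom A B) (q : Hom B Q) (x : Hom T B) :
  is_cokernel f q -> q ∘ x = 0 ->
  exists (P : C) (p : Hom P T) (y : Hom P A), epi p /\ f ∘ y = x ∘ p.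
Proof.
move=> cq; apply: (exact_lift abC); split; first by case: cq.
have [I [m [e [mm ee me]]]] := image_factor abC f.
have cm : is_cokernel m q.
  apply: is_cokernelP => [||S s sm]; first exact: cokernel_epi cq.
    by apply: (epi_eq0 ee); rewrite -compA me (proj1 cq).
  by apply: (cokernel_lift cq); rewrite -me compA sm comp0m.
have km := mono_kernel_cokernel abC mm cm.
move=> K k kk h kh; have [u ku] := kernel_lift kk (proj1 km).
have [v mv] := kernel_lift km (proj1 kk).
have uv : u ∘ v = idm K by apply: (kernel_mono kk); rewrite compA ku mv compm1.
have -> : h = u ∘ e by apply: (kernel_mono kk); rewrite kh compA ku me.
apply: epi_comp ee; apply: (@epi_compr _ _ _ _ _ v).
by rewrite uv => S f' g'; rewrite !compm1.
Qed.

Section Ext1.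
Variables (C : category) (abC : is_abelian C) (D : divisor C).
Variables (Y : weakly_closed_subspace C).
Hypothesis YE : forall M, Y M <-> div_eta D M = 0.

Let R := twist D.
Let eta := div_eta D.
Let F : functor C C := compF (direct_image Y) (shriek Y).
Let eps (M : C) : Hom (F M) M := adj_counit (shriek_adj Y) M.

Let eps_kernel (M : C) : is_kernel (eta M) (eps M).
Proof. exact: shriek_counit_kernel. Qed.

Let eps_nat (M N : C) (f : Hom M N) : eps N ∘ fmap F f = f ∘ eps M.
Proof. exact: counit_nat. Qed.

Let eps_mono (M : C) : mono (eps M) := kernel_mono (eps_kernel M).

Let coker_eta (M : C) : {Q : C & {q : Hom (R M) Q | is_cokernel (eta M) q}}.
Proof.
have /constructive_indefinite_description[Q Qq] := ab_cokernel abC (eta M).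
by exists Q; apply: constructive_indefinite_description.
Qed.

Let ext_ob (M : C) : C := projT1 (coker_eta M).
Let kap (M : C) : Hom (R M) (ext_ob M) := sval (projT2 (coker_eta M)).
Let kap_cokernel M : is_cokernel (eta M) (kap M) := svalP (projT2 (coker_eta M)).
Let kap_epi M : epi (kap M) := cokernel_epi (kap_cokernel M).

Let ext_map (M N : C) (f : Hom M N) :
  {g : Hom (ext_ob M) (ext_ob N) | g ∘ kap M = kap N ∘ fmap R f}.
Proof.
apply: constructive_indefinite_description; apply: (cokernel_lift (kap_cokernel M)).
by rewrite -compA -div_eta_nat compA (proj1 (kap_cokernel N)) comp0m.
Qed.

Let ext_mapE (M N : C) (f : Hom M N) :
  sval (ext_map f) ∘ kap M = kap N ∘ fmap R f := svalP (ext_map f).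

Definition ext1_divisor : functor C C.
Proof.
exists ext_ob (fun M N f => sval (ext_map f)).
- by move=> A; apply: kap_epi; rewrite ext_mapE fmap1 compm1 comp1m.
- move=> A B E g f; apply: kap_epi; rewrite ext_mapE fmapM.
  by rewrite -[RHS]compA ext_mapE [RHS]compA ext_mapE compA.
Defined.

Lemma ext1_divisor_zero (M : C) : epi (eta M) <-> idm (ext1_divisor M) = 0.
Proof.
split=> [em|z].
  apply: kap_epi; rewrite comp1m comp0m.
  by apply: (epi_eq0 em); case: (kap_cokernel M).
have k0 : kap M = 0 by rewrite -[kap M]comp1m [X in X ∘ _]z comp0m.
apply: epi0P => T f fe; have [h <-] := cokernel_lift (kap_cokernel M) fe.
by rewrite k0 compm0.
Qed.

(* H^1 of a resolution E of M is coker (M -> M(Y)): the class of a cocycle z is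
   computed by lifting z to r in E^0, whose image in E^0(Y) comes from M(Y). *)
Let class_spec (M : C) (E : injective_resolution M)
  (c : cohomology F E 1 (ext1_divisor M)) : Prop :=
  forall (T : C) (z : Hom T (cocycles c)) (r : Hom T (E 0)) (y : Hom T (R M)),
  res_d E 0 ∘ r = eps (E 1) ∘ cocycles_in c ∘ z ->
  fmap R (res_aug E) ∘ y = eta (E 0) ∘ r ->
  cocycles_class c ∘ z = kap M ∘ y.

Let F0 (A B : C) : fmap F (0 : Hom A B) = 0.
Proof. exact: (left_exact0 _ _ (shriek_left_exact abC Y)). Qed.

Let aug_kernel (M : C) (E : injective_resolution M) :
  is_kernel (fmap R (res_d E 0)) (fmap R (res_aug E)).
Proof.
exact: (proj2 (hom_left_exact (div_bimod D)) _ _ _ _ _ (res_aug_kernel E)).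
Qed.

Let eta_nat (M N : C) (f : Hom M N) : eta N ∘ f = fmap R f ∘ eta M.
Proof. exact: div_eta_nat. Qed.

Let class_unique (M : C) (E : injective_resolution M) (T : C)
  (r : Hom T (E 0)) (y : Hom T (R M)) :
  res_d E 0 ∘ r = 0 -> fmap R (res_aug E) ∘ y = eta (E 0) ∘ r -> kap M ∘ y = 0.
Proof.
move=> dr yE; have [s sE] := kernel_lift (res_aug_kernel E) dr.
have -> : y = eta M ∘ s.
  by apply: (kernel_mono (aug_kernel E)); rewrite yE -sE !compA eta_nat.
by rewrite compA (proj1 (kap_cokernel M)) comp0m.
Qed.

Let class_lift (M : C) (E : injective_resolution M) (T : C) (x : Hom T (E 1)) :
  res_d E 1 ∘ x = 0 -> eta (E 1) ∘ x = 0 ->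
  exists (P : C) (p : Hom P T) (r : Hom P (E 0)) (y : Hom P (R M)),
  [/\ epi p, res_d E 0 ∘ r = x ∘ p & fmap R (res_aug E) ∘ y = eta (E 0) ∘ r].
Proof.
move=> dx ex; have [P [p [r [ep rE]]]] := exact_lift abC (res_exact E 0) dx.
have [y yE] : exists y, fmap R (res_aug E) ∘ y = eta (E 0) ∘ r.
  apply: (kernel_lift (aug_kernel E)).
  by rewrite compA -eta_nat -compA rE compA ex comp0m.
by exists P, p, r, y.
Qed.

(** The start of the long exact sequence of [F E -> E -> E(Y)]: H^0(E) is [M], H^0(E(Y)) is [M(Y)]
    and H^1(E) vanishes. The map [cl] inverts the connecting map. *)
Lemma ext1_cohomology (M : C) (E : injective_resolution M) :
  exists c : cohomology F E 1 (ext1_divisor M), class_spec c.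
Proof.
have [Z [k kk]] := ab_kernel abC (fmap F (res_d E 1)).
pose i : Hom Z (E 1) := eps (E 1) ∘ k.
have mi : mono i by apply: mono_comp (kernel_mono kk).
have di : res_d E 1 ∘ i = 0.
  by rewrite compA -eps_nat -compA (proj1 kk) compm0.
have ei : eta (E 1) ∘ i = 0 by rewrite compA (proj1 (eps_kernel _)) comp0m.
have [P [p [r [y [ep rE yE]]]]] := class_lift di ei.
(* The class is defined on the cover [P]; it descends to [Z] because [class_unique] removes the
   ambiguity of the lift. *)
have [cl clE] : exists cl, cl ∘ p = kap M ∘ y.
  have [J [j kj]] := ab_kernel abC p.
  apply: (cokernel_lift (epi_cokernel_kernel abC ep kj)); rewrite -compA.
  apply: (@class_unique M E J (r ∘ j)); last by rewrite !compA yE.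
  by rewrite compA rE -compA (proj1 kj) compm0.
have spec (T : C) (z : Hom T Z) (r2 : Hom T (E 0)) (y2 : Hom T (R M)) :
    res_d E 0 ∘ r2 = i ∘ z -> fmap R (res_aug E) ∘ y2 = eta (E 0) ∘ r2 ->
    cl ∘ z = kap M ∘ y2.
  move=> r2E y2E; have [T' [p' [w [ep' wE]]]] := pullback_epi abC z ep.
  apply: ep'; rewrite -!compA -wE compA clE -compA.
  apply/eqP; rewrite -subr_eq0 -compmB; apply/eqP.
  apply: (@class_unique M E T' (r ∘ w - r2 ∘ p')).
    by rewrite compmB !compA rE r2E -!compA wE subrr.
  by rewrite !compmB !compA yE y2E.
have [b bE] : exists b, k ∘ b = fmap F (res_d E 0).
  by apply: (kernel_lift kk); rewrite -fmapM (proj1 (res_exact E 0)) F0.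
have clb : cl ∘ b = 0.
  rewrite (spec _ b (eps (E 0)) 0) ?compm0 //.
    by rewrite -compA bE eps_nat.
  by rewrite (proj1 (eps_kernel _)).
have ecl : epi cl.
  (* Surjectivity of [cl]: since [eta] is epi on injectives, a point of [M(Y)] lifts locally to
     [E 0], and the differential of the lift is a cocycle. *)
  have eE0 : epi (eta (E 0)) by apply: div_mono; apply: res_injective.
  have [T [p2 [r2 [ep2 r2E]]]] := pullback_epi abC (fmap R (res_aug E)) eE0.
  have [v vE] : exists v, eps (E 1) ∘ v = res_d E 0 ∘ r2.
    apply: (kernel_lift (eps_kernel _)).
    by rewrite compA eta_nat -compA r2E compA (proj1 (aug_kernel E)) comp0m.
  have [z zE] : exists z, k ∘ z = v.
    apply: (kernel_lift kk); apply: (@eps_mono (E 2)).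
    rewrite compA eps_nat -compA vE compA (proj1 (res_exact E 0)) comp0m.
    by rewrite compm0.
  apply: (@epi_compr _ _ _ _ _ z); rewrite (spec _ z r2 p2) //.
    exact: epi_comp.
  by rewrite -compA zE.
have ccl : is_cokernel b cl.
  have [S [t kt]] := ab_kernel abC cl.
  apply: is_cokernelP => // T h hb.
  apply: (cokernel_lift (epi_cokernel_kernel abC ecl kt)).
  have [S1 [p1 [w [ep1 wE]]]] := pullback_epi abC t ep.
  have kyw : kap M ∘ (y ∘ w) = 0.
    by rewrite compA -clE -compA wE compA (proj1 kt) comp0m.
  (* Where the class vanishes, [y] comes from some [s] in [M]; correcting [r] by [s] puts it in
     [F (E 0)], and the cocycle becomes a coboundary. *)
  have [S2 [p2 [s [ep2 sE]]]] := cokernel_exact abC (kap_cokernel M) kyw.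
  have [v vE] : exists v, eps (E 0) ∘ v = r ∘ w ∘ p2 - res_aug E ∘ s.
    apply: (kernel_lift (eps_kernel _)); rewrite compmB !compA -yE.
    by rewrite eta_nat -!compA (compA y) sE !compA subrr.
  have bv : b ∘ v = t ∘ p1 ∘ p2.
    apply: mi; rewrite /i -compA (compA k) bE [LHS]compA eps_nat -compA vE compmB.
    rewrite !compA rE (proj1 (res_aug_kernel E)) comp0m subr0.
    by rewrite -!compA (compA p) wE !compA.
  apply: (epi_eq0 ep1); apply: (epi_eq0 ep2).
  by rewrite -!compA (compA t) -bv compA hb comp0m.
exists (@Cohomology C C F M E 1 (ext1_divisor M) Z k b cl kk bE ccl).
by move=> T z r2 y2 /= r2E; apply: spec.
Qed.

(** A map of resolutions sends the lifting data of a cocycle to lifting data of its image, so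
    [class_spec] gives compatibility with the induced maps. *)
Lemma ext1_derived : is_right_derived F 1 ext1_divisor.
Proof.
pose H M (E : injective_resolution M) :=
  constructive_indefinite_description _ (ext1_cohomology E).
exists (fun M E => sval (H M E)) => M M' f E E' rho.
case: (H M E) (H M' E') => [c cS] [c' cS'] /= z zE.
have kc : is_kernel (fmap F (res_d E 1)) (cocycles_in c) by apply: cocycles_kernel.
have dc : res_d E 1 ∘ (eps (E 1) ∘ cocycles_in c) = 0.
  by rewrite compA -eps_nat -compA (proj1 kc) compm0.
have ec : eta (E 1) ∘ (eps (E 1) ∘ cocycles_in c) = 0.
  by rewrite compA (proj1 (eps_kernel _)) comp0m.
have [P [p [r [y [ep rE yE]]]]] := class_lift dc ec.
apply: ep; rewrite -!compA (cS _ p r y) //.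
rewrite (cS' _ (z ∘ p) (rho 0 ∘ r) (fmap R f ∘ y)).
- by rewrite !compA ext_mapE.
- rewrite [LHS]compA -rmap_d -[LHS]compA rE -!compA (compA _ z) zE !compA.
  by rewrite eps_nat.
- by rewrite [LHS]compA -fmapM -(rmap_aug rho) fmapM -compA yE !compA eta_nat.
Qed.

End Ext1.

(** Links the unspecified derived functor inside [is_Tor1] to [ext1_divisor]: only vanishing has to
    be transported. *)
Lemma cohomology_zero (C D : category) (F : functor C D) (M : C)
  (E : injective_resolution M) (n : nat) (H H' : D)
  (c : cohomology F E n H) (c' : cohomology F E n H') :
  idm H = 0 -> idm H' = 0.
Proof.
move=> H0; have [k' k0] := (cocycles_kernel c', cocycles_kernel c).
have [v vE] := kernel_lift k0 (proj1 k').
have [u uE] := kernel_lift k' (proj1 k0).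
have uv : u ∘ v = idm _ by apply: (kernel_mono k'); rewrite compA uE vE compm1.
have ub : u ∘ coboundaries c = coboundaries c'.
  by apply: (kernel_mono k'); rewrite compA uE !coboundariesE.
have cl0 : cocycles_class c = 0 by rewrite -[LHS]comp1m H0 comp0m.
apply: (cokernel_epi (class_cokernel c')); rewrite comp1m comp0m.
have [h hE] : exists h, h ∘ cocycles_class c = cocycles_class c' ∘ u.
  apply: (cokernel_lift (class_cokernel c)).
  by rewrite -compA ub (proj1 (class_cokernel c')).
by rewrite -[LHS]compm1 -uv compA -hE cl0 compm0 comp0m.
Qed.

(** * Restriction to a weakly closed subspace *)

Section ZeroBimodule.
Variables (C : category) (Z : C) (Z0 : is_zero Z).

Definition zero_functor : functor C C.
Proof.
exists (fun _ => Z) (fun _ _ _ => 0) => [A|A B E g f].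
  by rewrite (proj1 (Z0 Z) (idm Z)).
by rewrite compm0.
Defined.

Lemma zero_left_exact : left_exact zero_functor.
Proof.
split=> [A B f g|K A B f k _] /=; first by rewrite addr0.
apply: is_kernelP => [T x y _||T h _]; first by rewrite (proj1 (Z0 T) x) (proj1 (Z0 T) y).
  by rewrite compm0.
by exists 0; rewrite compm0 (proj1 (Z0 T) h).
Qed.

End ZeroBimodule.

Section InvariantSubspace.
Variables (X : space) (D : divisor X) (W : weakly_closed_subspace X).
Hypothesis HW : forall M : X, W M -> W (twist D M) /\ W (untwist D M).
Let abX : is_abelian X := gr_abelian (space_grothendieck X).
Let a : adjunction (untwist D) (twist D) := tensor_hom_adj (div_bimod D).

Definition sub_twist : functor (ModW W) (ModW W).
Proof.
exists (fun M => exist W (twist D (sval M)) (proj1 (HW (proj2_sig M))))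
       (fun A B f => fmap (twist D) (f : @Hom X (sval A) (sval B))).
- by move=> A; apply: (fmap1 (twist D)).
- by move=> A B E g f; apply: (fmapM (twist D)).
Defined.

Definition sub_untwist : functor (ModW W) (ModW W).
Proof.
exists (fun M => exist W (untwist D (sval M)) (proj2 (HW (proj2_sig M))))
       (fun A B f => fmap (untwist D) (f : @Hom X (sval A) (sval B))).
- by move=> A; apply: (fmap1 (untwist D)).
- by move=> A B E g f; apply: (fmapM (untwist D)).
Defined.

Definition sub_twist_adj : adjunction sub_untwist sub_twist.
Proof.
pose u : nat_trans (idF _) (compF sub_twist sub_untwist) :=
  @NatTrans _ _ (idF (ModW W)) (compF sub_twist sub_untwist)
    (fun M => adj_unit a (sval M))
    (fun A B f => ncompE (adj_unit a) (f : @Hom X (sval A) (sval B))).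
pose c : nat_trans (compF sub_untwist sub_twist) (idF _) :=
  @NatTrans _ _ (compF sub_untwist sub_twist) (idF (ModW W))
    (fun M => adj_counit a (sval M))
    (fun A B f => ncompE (adj_counit a) (f : @Hom X (sval A) (sval B))).
exists u c.
- by move=> M; apply: (adj_triL a (sval M)).
- by move=> M; apply: (adj_triR a (sval M)).
Defined.

Lemma sub_twist_left_exact : left_exact sub_twist.
Proof.
split=> [A B f g|K A B f k kk].
  exact: (proj1 (hom_left_exact (div_bimod D)) (sval A) (sval B)).
apply: (right_adjoint_kernel sub_twist_adj) kk => U V; exact: (twist0 D).
Qed.

Definition sub_bimod : bimodule (ModW W) :=
  @Bimodule _ (WeakBimodule sub_twist_left_exact) sub_untwist sub_twist_adj.

(** The quasi-inverse given by [invertible] need not preserve Mod W, but its substitute M(-Y) does,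
    with invertible unit and counit. *)
Lemma sub_bimod_invertible : invertible sub_bimod.
Proof.
have [ui ci] := equivalence_adj_iso (div_invertible D) a.
by apply: (@adj_equivalence _ _ _ _ sub_twist_adj) => M; [apply: ui | apply: ci].
Qed.

Definition sub_div_map : bimod_hom sub_bimod (o_space (ModW W)) :=
  @NatTrans _ _ (idF (ModW W)) sub_twist
    (fun M => div_map D (sval M))
    (fun A B f => ncompE (div_map D) (f : @Hom X (sval A) (sval B))).

Hypothesis shriek_epi :
  forall E : X, injective E -> epi (div_eta D (sval (shriek W E))).

(* An injective of Mod W is a retract of some alpha^! E. *)
Lemma sub_div_mono : bimod_mono sub_div_map.
Proof.
move=> E iE; apply: sub_epi => /=.
have [G genG] := gr_generator (space_grothendieck X).
have [J [j [mj iJ]]] := enough_injectives (space_grothendieck X) genG (sval E).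
have [h hE] := @shriek_factor X W E J j.
have mh : mono (h : @Hom (ModW W) E (shriek W J)).
  by apply: sub_mono; move: mj; rewrite -hE; apply: mono_compl.
have [g gh] := iE _ _ _ mh (idm E).
have {}gh : (g : @Hom X (sval (shriek W J)) (sval E)) ∘ h = idm (sval E) := gh.
(* By naturality, [div_eta] at [E] after [g] is the twist of [g] after [div_eta] at alpha^! J, and
   the twist of [g] is split by that of [h]. *)
apply: (@epi_compr _ _ _ _ _ (g : @Hom X _ _)).
rewrite -/(div_eta D (sval E)) div_eta_nat; apply: epi_comp; last exact: shriek_epi.
apply: (@epi_compr _ _ _ _ _ (fmap (twist D) h)); rewrite -fmapM gh fmap1.
by move=> T x y; rewrite !compm1.
Qed.

End InvariantSubspace.

(** * Effective divisors on a weakly closed subspace *)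

Theorem proposition8p2 (X : space) (Y : closed_subspace X) (D : divisor X)
  (HY : arises_from Y D) (W : weakly_closed_subspace X)
  (HW : forall M : X, W M -> W (twist D M) /\ W (untwist D M)) :
  (is_effective_divisor (cap W Y) <->
     ~ empty_subspace (cap W Y) /\
     (exists T : weak_bimodule X, is_Tor1 (o_sub Y) (o_sub W) T /\ bimod_zero T))
  /\
  ((exists T : weak_bimodule X, is_Tor1 (o_sub Y) (o_sub W) T /\ bimod_zero T)
   <->
   forall E : X, injective E ->
     is_zero (inverse_image Y (direct_image W (shriek W E)))).
Proof.
have grX := space_grothendieck X; have abX := gr_abelian grX.
have YE M : Y M <-> div_eta D M = 0.
  by split=> [/HY/untwist_map_eq0|/untwist_map_eq0/HY].
(* The unit exhibits i^* M as a quotient of [M] lying in Mod Y through which all others factor. *)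
have inverse_zero M : is_zero (inverse_image Y M) <-> epi (div_eta D M).
  have uM := @unit_epi X Y M.
  split=> [z|eM].
    apply: div_eta_epi => [|Q q eq /YE YQ]; first exact: ab_cokernel.
    pose Q' : ModW Y := exist Y Q YQ.
    rewrite [LHS](@adj_transposeR _ _ _ _ (inverse_image_adj Y) M Q' q).
    set g := adj_counit _ _ ∘ _; have -> : g = 0 by apply: (proj2 (z Q')).
    exact: comp0m.
  have q0 : (adj_unit (inverse_image_adj Y) M
             : @Hom X M (sval (inverse_image Y M))) = 0.
    apply: (@div_eta_epi_quotient X D M (sval (inverse_image Y M)) _ eM); apply/YE.
    exact: (proj2_sig (inverse_image Y M)).
  by apply: is_zero_id; apply: uM; rewrite q0 !compm0.
pose P := forall E : X, injective E -> epi (div_eta D (sval (shriek W E))).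
have TorP : (exists T : weak_bimodule X,
    is_Tor1 (o_sub Y) (o_sub W) T /\ bimod_zero T) <-> P.
  split=> [[T [[Ext1 [[H _] [t ti]]] T0]] E iE|shP].
    have [G genG] := gr_generator grX.
    (* Both [Ext1] and [ext1_divisor] compute the first cohomology of this resolution. *)
    have [R] := injective_resolution_exists grX genG (sval (shriek W E)).
    have [c _] := ext1_cohomology abX YE R.
    apply/(ext1_divisor_zero abX); apply: (cohomology_zero (H _ R) c).
    have [s [_ ts]] := ti (exist _ E iE).
    apply: etrans (esym ts) _.
    have -> : t (exist _ E iE) = 0 by apply: (proj2 (T0 E _)).
    exact: comp0m.
  have [Z Z0] := ab_zero abX.
  exists (WeakBimodule (zero_left_exact Z0)); split; last by move=> M.
  exists (ext1_divisor abX D); split; first exact: (ext1_derived abX YE).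
  have z E (iE : injective E) : idm (ext1_divisor abX D (sval (shriek W E))) = 0.
    by apply/ext1_divisor_zero/shP.
  pose K := compF (compF (ext1_divisor abX D) (hom_bimod (o_sub W)))
                  (incl (@injective X)).
  have tN (A B : full_sub (@injective X)) (f : Hom A B) :
      (0 : Hom Z (K B)) ∘ 0 = fmap K f ∘ (0 : Hom Z (K A)).
    by rewrite !compm0.
  exists (@NatTrans _ _ (compF (zero_functor Z0) (incl (@injective X))) K
            (fun A => 0) tN) => A.
  exists 0; split; first by rewrite comp0m; apply: esym; apply: (proj1 (Z0 Z)).
  by rewrite compm0; apply: esym; apply: (z _ (proj2_sig A)).
split; rewrite TorP; last first.
  by split=> HP E iE; apply/inverse_zero/HP.
split=> [[D' HD']|[ne shP]].
  have capE (M : ModW W) : Y (sval M) <-> div_eta D' M = 0.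
    by split=> [/(HD' M)/untwist_map_eq0|/untwist_map_eq0/(HD' M)].
  split=> [emp|E iE].
    (* Were the intersection empty, [div_eta D'] would be mono and epi on all of Mod W, against
       properness of [D']. *)
    have cap0 (M : ModW W) : div_eta D' M = 0 -> is_zero M.
      move=> /capE YM; apply: is_zero_id.
      by have /(_ (exist _ M YM))[+ _] := emp (exist _ M YM); apply.
    apply: (div_proper (d := D')) => M.
    apply: (sub_mono_epi_iso abX);
      first exact: (@div_eta_mono _ D' M (sub_kernel abX (W := W)) cap0).
    apply: (@div_eta_epi _ D' M (sub_cokernel abX (W := W))) => Q q _ /cap0 Q0.
    by apply: (proj1 (Q0 M)).
  apply: div_eta_epi => [|Q q eq /YE YQ]; first exact: ab_cokernel.
  (* A quotient of alpha^! E lying in Mod Y also lies in Mod W, where [div_eta D'] is epi on the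
     injective alpha^! E. *)
  have WQ : W Q := wc_quo eq (proj2_sig (shriek W E)).
  apply: (@div_eta_epi_quotient _ D' (shriek W E) (exist W Q WQ) q); last exact/capE.
  exact: (div_mono (d := D')) (shriek_injective abX iE).
(* On objects of the intersection the map is zero, so if it were invertible they would all
   vanish. *)
have proper : ~ bimod_iso (sub_div_map HW).
  move=> iso; apply: ne => M; apply: is_zero_id.
  have [g [gd _]] := iso (sval M).
  have d0 : div_eta D (sval (sval M)) = 0 by apply/YE; apply: (proj2_sig M).
  apply: etrans (esym gd) _.
  exact: etrans (congr1 (fun h => comp (c := X) g h) d0) (compm0 _ _).
exists (@Divisor _ (sub_bimod HW) (sub_div_map HW) (sub_bimod_invertible HW)
         (sub_div_mono shP) proper) => M.
exact: (HY (sval M)).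
Qed.
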